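(* Let $\mathbb{K}$ be a symmetric cone of rank $r$ in a finite-dimensional real inner product space $(\mathbb{E},\bullet)$, and suppose that $r\ge 5$. Then neither the copositive cone $\mathcal{COP}(\mathbb{K})$ nor the completely positive cone $\mathcal{CP}(\mathbb{K})$, regarded as subsets of the real vector space $\mathcal{S}(\mathbb{E})$ of self-adjoint linear transformations on $\mathbb{E}$, is a spectrahedral shadow.
   Context: A subset $K$ of a real vector space is a cone if $ax\in K$ for all $a\ge 0$, $x\in K$. A closed cone $\mathbb{K}$ in a finite-dimensional real inner product space $(\mathbb{E},\bullet)$ is a symmetric cone if it is self-dual ($\mathbb{K}=\{x\in\mathbb{E}\mid x\bullet y\ge 0\ \forall y\in\mathbb{K}\}$) and homogeneous (for any interior points $x,y$ of $\mathbb{K}$ there is an invertible linear $G:\mathbb{E}\to\mathbb{E}$ with $G(\mathbb{K})=\mathbb{K}$ and $G(x)=y$). Rank. A Jordan algebra is a finite-dimensional real vector space with a commutative bilinear product $\circ$ satisfying $x\circ(x^2\circ y)=x^2\circ(x\circ y)$, where $x^2:=x\circ x$; it is assumed to have a unit element. It is Euclidean if it has an inner product $\bullet$ that is associative: $(x\circ y)\bullet z=x\bullet(y\circ z)$. For every symmetric cone $\mathbb{K}$ in $(\mathbb{E},\bullet)$ there is a product $\circ$ on $\mathbb{E}$, unique up to Jordan algebra isomorphism, making $(\mathbb{E},\circ,\bullet)$ a Euclidean Jordan algebra with $\mathbb{E}_+:=\{x^2\mid x\in\mathbb{E}\}=\mathbb{K}$. An idempotent is $c$ with $c^2=c$; it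 is primitive if it is nonzero and not a sum of two nonzero idempotents; idempotents $c_1,\dots,c_k$ are orthogonal if $c_i\circ c_j=0$ for $i\ne j$. A Jordan frame is a set $\{c_1,\dots,c_r\}$ of orthogonal primitive idempotents whose sum is the unit element; the number $r$ does not depend on the frame and is the rank of $\mathbb{E}$. The rank of $\mathbb{K}$ is the rank of its associated Euclidean Jordan algebra. Copositive and completely positive cones. For $a,b\in\mathbb{E}$, $a\otimes b$ denotes the linear transformation $x\mapsto (b\bullet x)a$. Then $\mathcal{COP}(\mathbb{K}):=\{A\in\mathcal{S}(\mathbb{E})\mid x\bullet A(x)\ge 0\ \forall x\in\mathbb{K}\}$ and $\mathcal{CP}(\mathbb{K}):=\{\sum_{i=1}^m a_i\otimes a_i\mid m\ge 1,\ a_1,\dots,a_m\in\mathbb{K}\}$. Spectrahedral shadow. Let $\mathbb{S}^d$ be the space of real symmetric $d\times d$ matrices and $\mathbb{S}^d_+$ its cone of positive semidefinite matrices. A subset $C$ of a finite-dimensional real vector space $X$ is a spectrahedral shadow if there exist a finite-dimensional real vector space $Y$, a positive integer $d$, a matrix $\boldsymbol{M}_0\in\mathbb{S}^d$, and a linear mapping $\boldsymbol{M}:X\times Y\to\mathbb{S}^d$ such that $C=\{x\in X\mid \exists y\in Y:\ \boldsymbol{M}_0+\boldsymbol{M}(x,y)\in\mathbb{S}^d_+\}$. *)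

(* Defs.v *)
From HB Require Import structures.
From mathcomp Require Import all_boot all_order all_algebra.
From mathcomp Require Import sesquilinear ring.
From mathcomp Require Import boolp classical_sets reals topology normedtype.

Set Implicit Arguments.
Unset Strict Implicit.
Unset Printing Implicit Defensive.

Import Order.TTheory GRing.Theory Num.Theory.
Import numFieldNormedType.Exports.

Local Open Scope classical_set_scope.
Local Open Scope ring_scope.

(* A finite-dimensional real inner product space is a pair of E : vectType R
   and dot : {dot E for idfun}, i.e. a symmetric positive definite bilinear
   form on E. *)

Section InnerProduct.
Context {R : realType} {E : vectType R} (dot : {dot E for idfun}).

Lemma dotC x y : dot x y = dot y x.
Proof. by rewrite (hermitian_subproof x y) expr0 mul1r. Qed.

Lemma dotDl x y z : dot (x + y) z = dot x z + dot y z.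
Proof. by rewrite linearDl. Qed.

Lemma dotZl a x z : dot (a *: x) z = a * dot x z.
Proof. by rewrite linearZl_LR. Qed.

Lemma dotDr x y z : dot z (x + y) = dot z x + dot z y.
Proof. by rewrite linearDr. Qed.

Lemma dotZr a x z : dot z (a *: x) = a * dot z x.
Proof. by rewrite linearZr_LR. Qed.

Lemma dot_suml (I : finType) (F : I -> E) z :
  dot (\sum_i F i) z = \sum_i dot (F i) z.
Proof. by apply: (big_morph (dot^~ z)) => [x y|]; rewrite ?dotDl// linear0l. Qed.

Lemma dot_sumr (I : finType) (F : I -> E) z :
  dot z (\sum_i F i) = \sum_i dot z (F i).
Proof. by rewrite dotC dot_suml; apply: eq_bigr => i _; exact: dotC. Qed.

Lemma dot_ge0 x : 0 <= dot x x.
Proof.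
by have [->|/neq0_dnorm_gt0/ltW//] := eqVneq x 0; rewrite linear0l.
Qed.

Lemma dot_cauchy_schwarz x y :
  dot x y <= Num.sqrt (dot x x) * Num.sqrt (dot y y).
Proof.
have [->|y0] := eqVneq y 0; first by rewrite linear0r linear0l sqrtr0 mulr0.
have yy : 0 < dot y y by exact: neq0_dnorm_gt0.
have xyge0 : 0 <= dot x x * dot y y by rewrite mulr_ge0 ?dot_ge0.
rewrite -sqrtrM ?dot_ge0// (le_trans (ler_norm _))// -sqrtr_sqr ler_sqrt//.
rewrite -subr_ge0 -(pmulr_rge0 _ yy).
have := dot_ge0 (dot y y *: x + (- dot x y) *: y).
rewrite dotDl !dotDr !dotZl !dotZr (dotC y x).
by congr (0 <= _); ring.
Qed.

Lemma dot_norm_triangle x y :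
  Num.sqrt (dot (x + y) (x + y)) <= Num.sqrt (dot x x) + Num.sqrt (dot y y).
Proof.
rewrite -(@ler_pXn2r _ 2)// ?nnegrE ?addr_ge0 ?sqrtr_ge0//.
rewrite sqrrD !sqr_sqrtr ?dot_ge0// dotDl !dotDr (dotC y x).
have := dot_cauchy_schwarz x y; rewrite -subr_ge0 => cs.
rewrite -subr_ge0.
have : 0 <= (Num.sqrt (dot x x) * Num.sqrt (dot y y) - dot x y) *+ 2.
  exact: mulrn_wge0.
by congr (0 <= _); ring.
Qed.

Lemma dot_normZ a x :
  Num.sqrt (dot (a *: x) (a *: x)) = `|a| * Num.sqrt (dot x x).
Proof.
rewrite dotZl dotZr mulrA -expr2 sqrtrM ?sqr_ge0//.
by rewrite sqrtr_sqr.
Qed.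

Lemma dot_norm_eq0 x : Num.sqrt (dot x x) = 0 -> x = 0.
Proof.
move=> /eqP; rewrite sqrtr_eq0; apply: contraTeq => /(@neq0_dnorm_gt0 _ _ _ dot).
by rewrite ltNge.
Qed.

End InnerProduct.

(* E equipped with the norm, hence the topology, of the inner product dot *)
Definition ip_space (R : realType) (E : vectType R) (dot : {dot E for idfun})
  : Type := E.

HB.instance Definition _ (R : realType) (E : vectType R)
  (dot : {dot E for idfun}) := GRing.Lmodule.copy (ip_space dot) E.
HB.instance Definition _ (R : realType) (E : vectType R)
    (dot : {dot E for idfun}) :=
  @Lmodule_isNormed.Build R (ip_space dot) (fun x => Num.sqrt (dot x x))
    (dot_norm_triangle dot) (dot_normZ dot) (@dot_norm_eq0 R E dot).

Section SymmetricCone.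
Context {R : realType} {E : vectType R} (dot : {dot E for idfun}).

Definition is_cone (K : set E) := forall (a : R) x, 0 <= a -> K x -> K (a *: x).

Definition self_dual (K : set E) :=
  K = [set x | forall y, K y -> 0 <= dot x y].

Definition homogeneous (K : set E) :=
  forall x y, interior (K : set (ip_space dot)) x ->
    interior (K : set (ip_space dot)) y ->
  exists G : 'End(E), [/\ bijective G, G @` K = K & G x = y].

Definition symmetric_cone (K : set E) :=
  [/\ is_cone K, closed (K : set (ip_space dot)), self_dual K & homogeneous K].

End SymmetricCone.

Section JordanAlgebra.
Context {R : realType} {E : vectType R}.
Implicit Types (prod : {bilinear E -> E -> E}) (dot : {dot E for idfun}).

Definition is_unit prod (e : E) := forall x, prod e x = x.

Definition jordan_algebra prod :=
  [/\ commutative prod,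
      forall x y, prod x (prod (prod x x) y) = prod (prod x x) (prod x y)
    & exists e, is_unit prod e].

Definition euclidean_jordan_algebra dot prod :=
  jordan_algebra prod /\
  forall x y z, dot (prod x y) z = dot x (prod y z).

Definition idempotent_elt prod (c : E) := prod c c = c.

Definition primitive_idempotent prod (c : E) :=
  [/\ idempotent_elt prod c, c != 0
    & ~ exists a b, [/\ idempotent_elt prod a, idempotent_elt prod b,
                        a != 0, b != 0 & c = a + b]].

(* Orthogonal nonzero idempotents are distinct, so the r members of such a
   family form a set of r elements. *)
Definition jordan_frame prod r (c : 'I_r -> E) :=
  [/\ forall i, primitive_idempotent prod (c i),
      forall i j, i != j -> prod (c i) (c j) = 0
    & is_unit prod (\sum_i c i)].

(* r is the rank of the Euclidean Jordan algebra associated with K. The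
   algebra is unique up to isomorphism and r does not depend on the frame, so
   asking for one algebra and one frame determines r. *)
Definition cone_rank dot (K : set E) (r : nat) :=
  exists prod, [/\ euclidean_jordan_algebra dot prod,
                   [set prod x x | x in [set: E]] = K
                 & exists c : 'I_r -> E, jordan_frame prod c].

End JordanAlgebra.

Section SelfAdjoint.
Context {R : realType} {E : vectType R} (dot : {dot E for idfun}).

Definition self_adjoint_defect (A : 'End(E)) : 'M[R]_(\dim {: E}) :=
  \matrix_(i, j) (dot (A (vbasis {: E})`_i) (vbasis {: E})`_j
                  - dot (vbasis {: E})`_i (A (vbasis {: E})`_j)).

Lemma self_adjoint_defect_is_linear : linear self_adjoint_defect.
Proof.
move=> a A B; apply/matrixP => i j; rewrite !mxE !lfunE /= !lfunE /=.
by rewrite dotDl dotDr dotZl dotZr; ring.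
Qed.

HB.instance Definition _ := GRing.isLinear.Build R 'End(E)
  'M[R]_(\dim {: E}) _ self_adjoint_defect self_adjoint_defect_is_linear.

(* S(E) as a subspace of 'End(E): see self_adjointP *)
Definition self_adjoint : {vspace 'End(E)} := lker (linfun self_adjoint_defect).

Lemma self_adjointP (A : 'End(E)) :
  reflect (forall x y, dot (A x) y = dot x (A y)) (A \in self_adjoint).
Proof.
rewrite memv_ker lfunE; apply: (iffP eqP) => [A0 x y|Asym].
  rewrite (coord_vbasis (memvf x)) (coord_vbasis (memvf y)) !(linear_sum A) /=.
  rewrite !dot_suml; apply: eq_bigr => i _.
  rewrite !dot_sumr; apply: eq_bigr => j _.
  have AZ a u : A (a *: u) = a *: A u by rewrite linearZ.
  rewrite !AZ !dotZl !dotZr; congr (_ * (_ * _)).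
  by move/matrixP: A0 => /(_ i j); rewrite !mxE => /eqP; rewrite subr_eq0 => /eqP.
by apply/matrixP => i j; rewrite !mxE Asym subrr.
Qed.

Definition tensor (x y : E) : 'End(E) := linfun (fun z => dot y z *: x).

Lemma tensorE x y z : tensor x y z = dot y z *: x.
Proof.
have lin : linear (fun z => dot y z *: x).
  by move=> a u v; rewrite dotDr dotZr scalerDl scalerA.
pose f := GRing.isLinear.Build _ _ _ _ _ lin.
pose F : {linear E -> E} := HB.pack (fun z => dot y z *: x) f.
exact: (lfunE F).
Qed.

Definition copositive_cone (K : set E) : set (subvs_of self_adjoint) :=
  [set A | forall x, K x -> 0 <= dot x ((vsval A : 'End(E)) x)].

Definition completely_positive_cone (K : set E) :
    set (subvs_of self_adjoint) :=
  [set A | exists m (a : 'I_m -> E),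
     [/\ (0 < m)%N, forall i, K (a i)
       & vsval A = \sum_i tensor (a i) (a i)]].

End SelfAdjoint.

Arguments copositive_cone {R E} dot K A.
Arguments completely_positive_cone {R E} dot K A.

(* membership in the cone of positive semidefinite symmetric matrices *)
Definition is_psd (R : realType) d (A : 'M[R]_d) :=
  A^T = A /\ forall v : 'cV[R]_d, 0 <= (v^T *m A *m v) 0 0.

Definition spectrahedral_shadow (R : realType) (X : vectType R) (C : set X) :=
  exists (Y : vectType R) (d : nat) (M0 : 'M[R]_d)
         (M : {linear (X * Y)%type -> 'M[R]_d}),
    [/\ (0 < d)%N, M0^T = M0, forall p, (M p)^T = M p
      & C = [set x | exists y : Y, is_psd (M0 + M (x, y))]].

(* Main.v *)
(* Suppose COP(K) or CP(K) is a spectrahedral shadow C, and let c_0, ..., c_4 be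
   orthogonal elements of K taken from a Jordan frame.  For positive sequences
   x_0(n), ..., x_4(n), C contains A(n) = sum_ij H_ij x_i x_j c_i (x) c_j, with H
   the Horn matrix (for CP: H_ij = 1), so that M0 + M(A(n), y(n)) = B(n) B(n)^T
   for some y(n) and B(n).
   Along a nonprincipal ultrafilter, the functions of n occurring in this
   identity expand in finitely many functions u_k of pairwise different growth.
   Rescaling each u_k by a number psi(u_k) depending only on its growth rate
   keeps the right-hand side positive semidefinite as soon as the matrix
   psi(w_i w_j) is positive definite, the w_i being the functions of different
   growth in which B expands.  The x_i are chosen to grow independently; growth
   rates are then exponent vectors in R^(5+m), and psi is a functional on
   polynomials with real exponents that is positive on squares.  Hence
   sum_ij H_ij psi(x_i x_j) x_i x_j c_i (x) c_j lies in C, and testing it against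
   sum_i c_i / (x_i |c_i|^2) shows that psi is nonnegative on the Horn form (for
   CP the roles of matrix and test vector are exchanged).
   But some psi is negative on it.  On the face {i, i+1, i+2} the Horn form is
   (y_i - y_(i+1) + y_(i+2))^2; a polynomial, even with real exponents, vanishing
   on all five zero sets has opposite coefficients at y_(i+1) and y_(i+2) for
   every i, hence zero coefficients there as 5 is odd.  So these coefficients
   are controlled by point evaluations at zeros of the Horn form, and one may
   subtract from the sum of these evaluations a small multiple of the coefficient
   of y_0^2. *)

Require Import Defs.
From mathcomp Require Import all_boot all_order all_algebra.
From mathcomp Require Import sesquilinear ring lra.
From mathcomp Require Import all_classical all_reals all_analysis.

Set Implicit Arguments.
Unset Strict Implicit.
Unset Printing Implicit Defensive.

Import Order.TTheory GRing.Theory Num.Theory numFieldNormedType.Exports.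

Local Open Scope classical_set_scope.
Local Open Scope ring_scope.

(** * Germs along an ultrafilter *)

Section Germs.
Context (R : realType) (U : set_system nat) {UU : UltraFilter U}.
Implicit Types f g h : nat -> R.

(** Little-o along [U]. As division by 0 gives 0, it holds trivially when [g] vanishes along [U];
    hence the companion hypotheses [nonzero]. *)
Definition negligible f g := f n / g n @[n --> U] --> 0.

Definition comparable f g := exists2 c : R, c != 0 & f n / g n @[n --> U] --> c.

Definition nonzero f := \forall n \near U, f n != 0.

Lemma limit_unique f (a b : R) :
  f n @[n --> U] --> a -> f n @[n --> U] --> b -> a = b.
Proof. by apply: cvg_unique; exact: Rhausdorff. Qed.

Lemma ultra_dec (P : nat -> Prop) :
  (\forall n \near U, P n) \/ (\forall n \near U, ~ P n).
Proof. exact: (in_ultra_setVsetC P). Qed.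

Lemma ultra_pigeonhole (I : finType) (k : nat -> I) :
  exists i, \forall n \near U, k n = i.
Proof.
apply: contrapT => /forallNP kP.
have kN i : \forall n \near U, k n <> i by case: (ultra_dec (fun n => k n =
  i)) => // /kP.
have /filter_ex[n kn] : \forall n \near U, forall i, k n <> i by exact: filter_forall.
exact: (kn (k n)).
Qed.

(** Compactness of [[-M, M]] gives a cluster point, and an ultrafilter converges to each of its
    cluster points. *)
Lemma ultra_bounded_cvg f (M : R) :
  (\forall n \near U, `|f n| <= M) -> exists l : R, f n @[n --> U] --> l.
Proof.
move=> fM; have fU : fmap f U `[- M, M]%classic.
  by apply: filterS fM => n; rewrite /= in_itv/= ler_norml.
have [l [_ cl]] := segment_compact _ fU.
exists l => B lB; case: (ultra_dec (fun n => B (f n))) => // nB.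
have [x [xB]] := cl [set x | ~ B x] B nB lB.
by [].
Qed.

(** One of [f / g] and [g / f] is bounded by 1 along the ultrafilter, hence convergent; the three
    cases are read off from its limit. *)
Lemma negligible_or_comparable f g : nonzero f -> nonzero g ->
  [\/ negligible f g, negligible g f | comparable f g].
Proof.
move=> f0 g0.
case: (ultra_dec (fun n => `|f n / g n| <= 1)) => [le1|gt1].
  have [l fgl] := ultra_bounded_cvg le1.
  have [l0|l0] := eqVneq l 0; first by apply: Or31; rewrite /negligible -l0.
  by apply: Or33; exists l.
have le1 : \forall n \near U, `|g n / f n| <= 1.
  near=> n.
  have /negP : ~ `|f n / g n| <= 1 by near: n.
  rewrite -ltNge => gt.
  rewrite -(invf_div (f n)) normfV invf_le1 ?ltW//.
  exact: lt_trans gt.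
have [l fgl] := ultra_bounded_cvg le1.
have [l0|l0] := eqVneq l 0; first by apply: Or32; rewrite /negligible -l0.
apply: Or33; exists l^-1; first by rewrite invr_eq0.
apply: cvg_trans (cvgV l0 fgl); apply: near_eq_cvg.
by near=> n; rewrite /= invf_div.
Unshelve. all: by end_near. Qed.

Lemma comparable_nnegligible f g : comparable f g -> ~ negligible f g.
Proof.
by move=> [c /eqP c0 fgc] fg0; have := limit_unique fgc fg0.
Qed.

Lemma comparable_sym f g : comparable f g -> comparable g f.
Proof.
move=> [c c0 fg]; exists c^-1; first by rewrite invr_eq0.
by apply: cvg_trans (cvgV c0 fg); apply: near_eq_cvg; apply: nearW => n /=;
  rewrite invf_div.
Qed.

Lemma negligible_trans_comparable f g h : nonzero f ->
  comparable f g -> negligible f h -> negligible g h.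
Proof.
move=> f0 [c c0 fgc] fh.
rewrite /negligible -(mulr0 c^-1); apply: cvg_trans (cvgM (cvgV c0 fgc) fh).
apply: near_eq_cvg; near=> n => /=.
have fn : f n != 0 by near: n.
by rewrite invf_div mulrA mulfVK.
Unshelve. all: by end_near. Qed.

Definition separated f g := negligible f g \/ negligible g f.

(** For each [n] some [u i] with nonzero coefficient is largest in absolute value; by pigeonhole the
    index is constant along [U]. Admitting every [c'] supported where [c] is lets one [k] serve both
    an expansion and its rescaling. *)
Lemma dominant_term (I : finType) (u : I -> nat -> R) (c : I -> R) :
  (forall i, nonzero (u i)) ->
  (forall i j, i != j -> separated (u i) (u j)) ->
  (exists i, c i != 0) ->
  exists2 k, c k != 0 & forall c' : I -> R, (forall i, c i = 0 -> c' i = 0) ->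
    (\sum_i c' i * u i n) / u k n @[n --> U] --> c' k.
Proof.
move=> u0 usep [i0 ci0].
have [k kP] := ultra_pigeonhole (fun n => [arg max_(i > i0 | c i != 0) `|u i n|]%O).
have kmax : \forall n \near U, c k != 0 /\ forall i, c i != 0 -> `|u i n| <= `|u k n|.
  apply: filterS kP => n <-.
  by case: Order.TotalTheory.arg_maxP => //.
have ck : c k != 0 by have [n []] := filter_ex kmax.
have small i : i != k -> c i != 0 -> negligible (u i) (u k).
  move=> ik ci; have [//|ki] := usep _ _ ik.
  exfalso.
  have lt1 : \forall n \near U, `|u k n / u i n| < 1.
    by apply: (cvgr_norm_lt (0 : R) ki); rewrite normr0.
  have [n [[lt [_ le]] un]] := filter_ex (filterI (filterI lt1 kmax) (u0 i)).
  move: (le _ ci) lt => {}le;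
    rewrite normrM normfV ltr_pdivrMr ?normr_gt0// mul1r ltNge.
  by rewrite le.
exists k => // c' c'0.
have -> : c' k = \sum_i (if i == k then c' k else 0).
  by rewrite -big_mkcond big_pred1_eq.
apply: (@cvg_trans _ ((fun n => \sum_i c' i * (u i n / u k n)) n @[n --> U])).
  apply: near_eq_cvg; near=> n => /=.
  by rewrite mulr_suml; apply: eq_bigr => i _; rewrite mulrA.
apply: cvg_big => //; first exact: add_continuous.
move=> i _; have [->|ik] := eqVneq i k.
  rewrite -[X in _ --> X]mulr1; apply: cvgM; first exact: cvg_cst.
  apply: cvg_near_cst; near=> n => /=.
  by rewrite divff//; near: n; exact: u0.
have [/c'0 ->|ci] := eqVneq (c i) 0.
  apply: cvg_near_cst; near=> n => /=.
  by rewrite mul0r.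
rewrite -[X in _ --> X](mulr0 (c' i)); apply: cvgM; first exact: cvg_cst.
exact: small.
Unshelve. all: by end_near. Qed.

Lemma separated_free (I : finType) (u : I -> nat -> R) (c : I -> R) :
  (forall i, nonzero (u i)) ->
  (forall i j, i != j -> separated (u i) (u j)) ->
  (\forall n \near U, \sum_i c i * u i n = 0) -> forall i, c i = 0.
Proof.
move=> u0 usep sum0 i; apply/eqP/negPn/negP => ci.
have [k ck /(_ c (fun _ => id)) lim] :=
  dominant_term u0 usep (ex_intro (fun i => c i != 0) i ci).
move/eqP : ck; apply; apply: (limit_unique lim).
apply: cvg_near_cst; near=> n => /=.
have -> : \sum_i c i * u i n = 0 by near: n.
by rewrite mul0r.
Unshelve. all: by end_near. Qed.

Definition separated_seq (s : seq (nat -> R)) :=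
  (forall i : 'I_(size s), nonzero (nth 0 s i)) /\
  (forall i j : 'I_(size s), i != j -> separated (nth 0 s i) (nth 0 s j)).

Definition in_span (s : seq (nat -> R)) f :=
  exists c : nat -> R,
    \forall n \near U, f n = \sum_(k < size s) c k * nth 0 s k n.

Lemma in_span_cat s s' f : in_span s f -> in_span (s ++ s') f.
Proof.
move=> [c cf]; exists (fun k => if (k < size s)%N then c k else 0).
apply: filterS cf => n ->; rewrite size_cat big_split_ord/= [X in _ = _ + X]big1 ?addr0.
  by apply: eq_bigr => i _; rewrite ltn_ord nth_cat ltn_ord.
by move=> i _; rewrite ltnNge leq_addr/= mul0r.
Qed.

Lemma in_span_nth s k : (k < size s)%N -> in_span s (nth 0 s k).
Proof.
move=> ks; exists (fun j => (j == k)%:R); apply: nearW => n.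
rewrite (bigD1 (Ordinal ks))//= eqxx mul1r big1 ?addr0// => i ik.
by rewrite (negbTE (_ : _ != k))// ?mul0r.
Qed.

(** Induction on the number of members of [s] to which [f] is not negligible. If [f] is comparable
    to some member, subtracting the right multiple of it lowers this number; if to none, [f] itself
    is appended. *)
Lemma extend_separated s f : separated_seq s ->
  exists s', separated_seq (s ++ s') /\ in_span (s ++ s') f.
Proof.
move=> [s0 ssep].
pose big g := [pred k : 'I_(size s) | ~~ `[< negligible g (nth 0 s k) >]].
have [m] := ubnP #|big f|; elim: m f => // m IH f /ltnSE fm.
case: (ultra_dec (fun n => f n = 0)) => [f0|fn0].
  exists [::]; rewrite cats0; split=> //; exists (fun=> 0).
  by apply: filterS f0 => n ->; rewrite big1// => i _; rewrite mul0r.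
have {}fn0 : nonzero f by apply: filterS fn0 => n /eqP.
have [[k fk]|/forallNP nk] :=
  pselect (exists k : 'I_(size s), comparable f (nth 0 s k)); last first.
  exists [:: f]; split; last first.
    have := @in_span_nth (s ++ [:: f]) (size s).
    by rewrite size_cat/= addn1 nth_cat ltnn subnn; exact.
  have sep i : separated (nth 0 s i) f \/ (size s <= i)%N.
    case: (ltnP i (size s)) => is_; [left|by right].
    case: (negligible_or_comparable fn0 (s0 (Ordinal is_))) => [||/nk//] ?.
      by right.
    by left.
  split=> [i|i j].
    rewrite nth_cat; case: ifPn => [is_|]; first exact: (s0 (Ordinal is_)).
    by have := ltn_ord i; rewrite {2}size_cat/= addn1 ltnS -leqNgt => h1 h2;
       rewrite (_ : (i - size s)%N = 0%N)//; apply/eqP; rewrite subn_eq0.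
  have last_ (l : 'I_(size (s ++ [:: f]))) : (size s <= l)%N -> l = size s :> nat.
    have := ltn_ord l; rewrite {2}size_cat/= addn1 ltnS => h1 h2.
    by apply/eqP; rewrite eqn_leq h1.
  move=> ij; rewrite !nth_cat; case: ifPn => [is_|]; case: ifPn => [js|].
  - exact: (ssep (Ordinal is_) (Ordinal js)).
  - rewrite -leqNgt => /last_ ->; rewrite subnn.
    by have [//|] := sep i; rewrite leqNgt is_.
  - rewrite -leqNgt => /last_ ->; rewrite subnn/=.
    have [|] := sep j; last by rewrite leqNgt js.
    by move=> [?|?]; [right|left].
  - rewrite -!leqNgt => /last_ jE /last_ iE; move/eqP : ij; case.
    by apply: val_inj => /=; rewrite iE jE.
have nfk := comparable_nnegligible fk.
have [c c0 fkc] := fk; pose f' n := f n - c * nth 0 s k n.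
have f'k : negligible f' (nth 0 s k).
  rewrite /negligible -(subrr c); apply: cvg_trans (cvgB fkc (cvg_cst c)).
  apply: near_eq_cvg; near=> n => /=.
  by rewrite /f' mulrBl mulfK//; near: n; exact: s0.
have [s' [ss' [d dE]]] : exists s', separated_seq (s ++ s') /\ in_span (s ++ s') f'.
  apply: IH; apply: leq_trans fm; apply: proper_card; apply/properP; split.
    apply/fintype.subsetP => l; rewrite !inE; apply: contra => /asboolP fl.
    apply/asboolP; have kl := negligible_trans_comparable fn0 fk fl.
    rewrite /negligible; have -> : 0 = 0 - c * 0 by rewrite mulr0 subr0.
    apply: cvg_trans (cvgB fl (cvgM (cvg_cst c) kl)).
    apply: near_eq_cvg; near=> n => /=.
    by rewrite /f' !fctE mulrBl -mulrA.
  exists k; rewrite !inE; first by apply/asboolP.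
  by rewrite negbK; apply/asboolP.
exists s'; split=> //.
exists (fun j => d j + c * (j == k :> nat)%:R).
apply: filterS dE => n; rewrite /f' => /eqP; rewrite subr_eq => /eqP ->.
under [RHS]eq_bigr do rewrite mulrDl.
rewrite big_split/=; congr (_ + _).
have ks : (k < size (s ++ s'))%N by rewrite size_cat (leq_trans (ltn_ord k))// leq_addr.
rewrite (bigD1 (Ordinal ks))//= eqxx mulr1 nth_cat ltn_ord big1 ?addr0// => i ik.
by rewrite (_ : _ == _ = false) ?mulr0 ?mul0r//; exact/negbTE.
Unshelve. all: by end_near. Qed.

Lemma extend_separated_seq s fs : separated_seq s ->
  exists s', separated_seq (s ++ s') /\
    forall i, (i < size fs)%N -> in_span (s ++ s') (nth 0 fs i).
Proof.
elim: fs s => [|f fs IH] s ss; first by exists [::]; rewrite cats0.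
have [s1 [ss1 sf]] := extend_separated f ss.
have [s2 [ss2 sfs]] := IH _ ss1.
exists (s1 ++ s2); rewrite catA; split=> // -[|i] /=.
  by move=> _; exact: in_span_cat.
exact: sfs.
Qed.

End Germs.

(** * Positive semidefinite matrices *)

Lemma quadratic_form_recr (R : realType) d (N : nat -> nat -> R) (v : nat -> R) :
  (forall i j, N i j = N j i) ->
  \sum_(i < d.+1) \sum_(j < d.+1) v i * v j * N i j =
  \sum_(i < d) \sum_(j < d) v i * v j * N i j
    + 2 * v d * (\sum_(i < d) v i * N i d) + v d ^+ 2 * N d d.
Proof.
move=> Nsym; rewrite big_ord_recr/= big_ord_recr/=.
under eq_bigr do rewrite big_ord_recr/=.
rewrite big_split/=.
have -> : \sum_(i < d) v i * v d * N i d = v d * \sum_(i < d) v i * N i d.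
  by rewrite mulr_sumr; apply: eq_bigr => i _; ring.
have -> : \sum_(i < d) v d * v i * N d i = v d * \sum_(i < d) v i * N i d.
  by rewrite mulr_sumr; apply: eq_bigr => i _; rewrite (Nsym d i); ring.
ring.
Qed.

Lemma quadratic_ge0_linear0 (R : realType) (b c : R) :
  (forall t, 0 <= b * t + c) -> b = 0.
Proof.
move=> H; apply/eqP/negPn/negP => b0.
have := H (- (c + 1) / b).
by rewrite mulrC mulfVK// opprD addrAC addNr add0r ler0N1.
Qed.

(** Cholesky factorisation by induction: the factor of the Schur complement of the last diagonal
    entry is bordered by one column. *)
Lemma psd_gram (R : realType) d (N : nat -> nat -> R) :
  (forall i j, N i j = N j i) ->
  (forall v : nat -> R, 0 <= \sum_(i < d) \sum_(j < d) v i * v j * N i j) ->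
  exists B : nat -> nat -> R, forall i j, (i < d)%N -> (j < d)%N ->
    N i j = \sum_(k < d) B i k * B j k.
Proof.
elim: d N => [|d IH] N Nsym Npsd; first by exists (fun _ _ => 0).
have Ndd : 0 <= N d d.
  pose v i : R := (i == d)%:R.
  have := Npsd v; rewrite quadratic_form_recr// /v eqxx.
  rewrite big1 => [|i _]; last first.
    by rewrite big1// => j _; rewrite ltn_eqF// !mul0r.
  rewrite big1 => [|i _]; last by rewrite ltn_eqF// !mul0r.
  by rewrite mulr0 !add0r expr1n mul1r.
(* If [N d d = 0], the form at [e_i + t e_d] is affine in [t] and nonnegative, so its slope
   [2 N i d] vanishes. *)
have col0 i : (i < d)%N -> N d d = 0 -> N i d = 0.
  move=> id_ dd0; have two0 : 2 != 0 :> R by rewrite pnatr_eq0.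
  apply: (mulIf two0).
  rewrite mul0r; apply: (@quadratic_ge0_linear0 _ _ (N i i)) => t.
  pose v j : R := (j == i)%:R + t * (j == d)%:R.
  have := Npsd v; rewrite quadratic_form_recr// /v eqxx (gtn_eqF id_) add0r mulr1 dd0
    mulr0 addr0.
  rewrite (bigD1 (Ordinal id_))//= (bigD1 (Ordinal id_))//= eqxx.
  rewrite (ltn_eqF id_) mulr0 addr0 big1 => [|j ji]; last first.
    rewrite (negbTE (_ : _ != i))//.
    by rewrite (ltn_eqF (ltn_ord j)) mulr0 addr0 mulr0 mul0r.
  rewrite big1 => [|j ji]; last first.
    rewrite big1// => k _; rewrite (negbTE (_ : j != i :> nat))//.
    by rewrite (ltn_eqF (ltn_ord j)) mulr0 addr0 !mul0r.
  rewrite (bigD1 (Ordinal id_))//= eqxx (ltn_eqF id_) big1 => [|j ji]; last first.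
    rewrite (negbTE (_ : j != i :> nat))//.
    by rewrite (ltn_eqF (ltn_ord j)) mulr0 addr0 !mul0r.
  by rewrite mulr1n mulr0n; congr (0 <= _); ring.
have [||B BE] := IH (fun i j => N i j - N i d * N j d / N d d).
- by move=> i j; rewrite Nsym [N i d * _]mulrC.
- move=> v; pose s := \sum_(i < d) v i * N i d.
  (* The last coordinate minimises the form when [N d d > 0]; when [N d d = 0] it is 0, because
     division by 0 gives 0. *)
  pose v' i := if i == d then - s / N d d else v i.
  have := Npsd v'; rewrite quadratic_form_recr// /v' eqxx.
  under eq_bigr => i _ do (under eq_bigr => j _ do rewrite !ltn_eqF//).
  under [X in _ + _ * X + _]eq_bigr => i _ do rewrite ltn_eqF//.
  rewrite -/s; congr (0 <= _).
  have -> : \sum_(i < d) \sum_(j < d) v i * v j * (N i j - N i d * N j d / N d d)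
    = \sum_(i < d) \sum_(j < d) v i * v j * N i j - s * s / N d d.
    under eq_bigr do under eq_bigr do rewrite mulrBr.
    under eq_bigr do rewrite sumrB.
    rewrite sumrB; congr (_ - _); rewrite /s !mulr_suml; apply: eq_bigr => i _.
    rewrite mulr_sumr mulr_suml; apply: eq_bigr => j _; ring.
  have [->|dd0] := eqVneq (N d d) 0; first by rewrite invr0; ring.
  by field.
exists (fun i k => if (i < d)%N then
    if (k < d)%N then B i k else N i d / Num.sqrt (N d d)
  else if (k < d)%N then 0 else Num.sqrt (N d d)).
have sqrtdd : Num.sqrt (N d d) * Num.sqrt (N d d) = N d d.
  by rewrite -expr2 sqr_sqrtr.
have sqrt0 i : (i < d)%N -> N i d = N i d / Num.sqrt (N d d) * Num.sqrt (N d d).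
  move=> id_; have [dd0|dd0] := eqVneq (N d d) 0.
    by rewrite (col0 _ id_ dd0) !mul0r.
  by rewrite mulfVK// sqrtr_eq0 -ltNge lt_neqAle eq_sym dd0.
move=> i j; rewrite !ltnS => id_ jd; rewrite big_ord_recr/= ltnn.
under eq_bigr do rewrite ltn_ord.
case: ltnP => id'; case: ltnP => jd'.
- rewrite -BE// -!mulrA; set a := Num.sqrt _.
  have -> : a^-1 * (N j d * a^-1) = N j d * (N d d)^-1.
    by rewrite -sqrtdd invfM -/a; ring.
  by ring.
- have -> : j = d by apply/eqP; rewrite eqn_leq jd.
  by rewrite big1 ?add0r -?sqrt0// => k _; rewrite mulr0.
- have -> : i = d by apply/eqP; rewrite eqn_leq id_.
  by rewrite big1 ?add0r 1?mulrC 1?Nsym -?sqrt0// => k _; rewrite mul0r.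
- have -> : j = d by apply/eqP; rewrite eqn_leq jd.
  have -> : i = d by apply/eqP; rewrite eqn_leq id_.
  by rewrite big1 ?add0r ?sqrtdd// => k _; rewrite mul0r.
Qed.

Section StronglyPositive.
Context (R : realType).

Definition strongly_positive (I : finType) (A : I -> I -> R) :=
  exists2 e, 0 < e & forall v : I -> R,
    e * (\sum_i v i ^+ 2) <= \sum_i \sum_j v i * v j * A i j.

(** Since [|v_i v_j|] is at most the mean of the squares, an entrywise error [e / m] changes the
    form by at most [e * (#|I| / m)] times the squared norm. Taking [m = #|I| + 1] also covers an
    empty [I]. *)
Lemma strongly_positive_perturb (I : finType) (A : I -> I -> R) :
  strongly_positive A -> exists2 e, 0 < e &
  forall A' : I -> I -> R, (forall i j, `|A i j - A' i j| <= e) ->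
  forall v : I -> R, 0 <= \sum_i \sum_j v i * v j * A' i j.
Proof.
move=> [e e0 Ae]; pose m := #|I|%:R + 1 : R.
have m0 : 0 < m by rewrite ltr_wpDl.
exists (e / m); first by rewrite divr_gt0.
move=> A' AA' v.
suff : \sum_i \sum_j v i * v j * A i j - \sum_i \sum_j v i * v j * A' i j
    <= e * (\sum_i v i ^+ 2).
  by have := Ae v; lra.
rewrite -sumrB; under eq_bigr do rewrite -sumrB.
have le2 i j : v i * v j * A i j - v i * v j * A' i j
    <= e / m * ((v i ^+ 2 + v j ^+ 2) / 2).
  rewrite -mulrBr (le_trans (ler_norm _))// normrM mulrC ler_pM//.
  by rewrite normrM -(real_normK (num_real (v i))) -(real_normK (num_real (v j)));
     have := sqr_ge0 (`|v i| - `|v j|); nra.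
apply: le_trans (ler_sum _ (fun i _ => ler_sum _ (fun j _ => le2 i j))) _.
have s0 : 0 <= \sum_i v i ^+ 2 by apply: sumr_ge0 => i _; exact: sqr_ge0.
have -> : \sum_i \sum_j (e / m * ((v i ^+ 2 + v j ^+ 2) / 2))
    = e / m * (#|I|%:R * \sum_i v i ^+ 2).
  under eq_bigr do rewrite -mulr_sumr -mulr_suml big_split/= sumr_const.
  rewrite -mulr_sumr -mulr_suml big_split/= sumr_const sumrMnl.
  by rewrite -(mulr_natl (\sum_i _)); field; rewrite lt0r_neq0.
rewrite -mulrA ler_pM2l// mulrC ler_pdivrMr// /m mulrDr mulr1 mulrC.
by rewrite lerDl.
Qed.

End StronglyPositive.

(** * Rescaling a lift *)

Lemma quadratic_form_substitute (R : realType) (I J : finType) (v : I -> R)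
    (p : I -> J -> R) (F : J -> J -> R) :
  \sum_i \sum_j v i * v j * \sum_x \sum_y p i x * p j y * F x y =
  \sum_x \sum_y (\sum_i v i * p i x) * (\sum_j v j * p j y) * F x y.
Proof.
rewrite !pair_bigA/=.
under eq_bigr do rewrite pair_bigA mulr_sumr/=.
under [RHS]eq_bigr do rewrite big_distrlr pair_bigA mulr_suml/=.
rewrite exchange_big/=; apply: eq_bigr => -[x y] _; apply: eq_bigr => -[i j] _ /=.
by ring.
Qed.

Section Transfer.
Context (R : realType) (U : set_system nat) {UU : UltraFilter U}.

Lemma extend_separated_fam (J : finType) (f : J -> nat -> R) s :
  separated_seq U s ->
  exists s', separated_seq U (s ++ s') /\ forall j, in_span U (s ++ s') (f j).
Proof.
move=> ss; have [s' [ss' sp]] := extend_separated_seq [seq f j | j <- enum J] ss.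
exists s'; split=> // j.
have jJ : (index j (enum J) < size (enum J))%N by rewrite index_mem mem_enum.
have := sp (index j (enum J)); rewrite size_map => /(_ jJ).
by rewrite (nth_map j)// nth_index ?mem_enum.
Qed.

Lemma separated_nil : separated_seq (R := R) U [::].
Proof. by split=> -[]. Qed.

(** The germs [x_i x_j] and [x_j x_i] coincide, so the family is separated only after removal of
    duplicates. *)
Lemma separated_undup (T : finType) (g : T -> nat -> R) :
  (forall t, nonzero U (g t)) ->
  (forall t t', g t = g t' \/ separated U (g t) (g t')) ->
  exists s, separated_seq U s /\ forall t, exists k : 'I_(size s), nth 0 s k = g t.
Proof.
move=> g0 gsep; pose s := undup [seq g t | t <- enum T].
have sg i : (i < size s)%N -> exists t, nth 0 s i = g t.
  move=> /(mem_nth 0); rewrite mem_undup => /mapP[t _ ->]; by exists t.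
exists s; split; [split|].
- by move=> i; have [t ->] := sg i (ltn_ord i).
- move=> i j ij; have [t tE] := sg i (ltn_ord i); have [t' tE'] := sg j (ltn_ord j).
  rewrite tE tE'; case: (gsep t t') => // gE.
  move/eqP : (gE); rewrite -tE -tE' nth_uniq ?undup_uniq// => /eqP/val_inj ijE.
  by rewrite ijE eqxx in ij.
- move=> t; have : g t \in s by rewrite mem_undup map_f ?mem_enum.
  rewrite -index_mem => ts; exists (Ordinal ts) => /=.
  by rewrite nth_index// -index_mem.
Qed.

(* Writing [w i * w j] in the basis [u] and rescaling each [u k] by [psi (u k)]
   multiplies [w i * w j] by [psi (w i * w j) + o(1)], because only the
   dominant [u k] matters. *)
Lemma rescale_gram (I K : finType) (w : I -> nat -> R) (u : K -> nat -> R)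
    (c : I -> I -> K -> R) (psi : (nat -> R) -> R) :
  (forall i, nonzero U (w i)) ->
  (forall k, nonzero U (u k)) ->
  (forall k l, k != l -> separated U (u k) (u l)) ->
  (forall i j, \forall n \near U, w i n * w j n = \sum_k c i j k * u k n) ->
  (forall f h, comparable U f h -> psi f = psi h) ->
  strongly_positive (fun i j => psi (w i \* w j)) ->
  \forall n \near U, forall v : I -> R,
    0 <= \sum_i \sum_j v i * v j * \sum_k c i j k * psi (u k) * u k n.
Proof.
move=> w0 u0 usep wE psiE psi_pos.
pose Phi i j n := \sum_k c i j k * psi (u k) * u k n.
have lim i j : Phi i j n / (w i n * w j n) @[n --> U] --> psi (w i \* w j).
  have ex_c : exists k, c i j k != 0.
    apply: contrapT => /forallNP c0.
    have [n [[wi wj]]] := filter_ex (filterI (filterI (w0 i) (w0 j)) (wE i j)).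
    rewrite big1 => [/eqP|k _]; first by rewrite mulf_eq0 (negbTE wi) (negbTE wj).
    by have /negP/negPn/eqP-> := c0 k; rewrite mul0r.
  have [k ck klim] := dominant_term u0 usep ex_c.
  have wu : (w i n * w j n) / u k n @[n --> U] --> c i j k.
    apply: cvg_trans (klim _ (fun _ => id)); apply: near_eq_cvg.
    by apply: filterS (wE i j) => n /= ->.
  have -> : psi (w i \* w j) = psi (u k) by apply: psiE; exists (c i j k).
  have -> : psi (u k) = c i j k * psi (u k) / c i j k by rewrite mulrC mulKf.
  have Pu : Phi i j n / u k n @[n --> U] --> c i j k * psi (u k).
    by apply: (klim (fun k => c i j k * psi (u k))) => l ->; rewrite mul0r.
  apply: cvg_trans (cvgM Pu (cvgV ck wu)); apply: near_eq_cvg.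
  apply: filterS (filterI (u0 k) (filterI (w0 i) (w0 j))) => n [uk [wi wj]] /=.
  by field; rewrite uk wi wj.
have [e e0 pert] := strongly_positive_perturb psi_pos.
have near_e : \forall n \near U, forall ij : I * I,
    `|psi (w ij.1 \* w ij.2) - Phi ij.1 ij.2 n / (w ij.1 n * w ij.2 n)| <= e.
  by apply: filter_forall => -[i j] /=; apply: cvgr_dist_le.
have near_w : \forall n \near U, forall i, w i n != 0 by exact: filter_forall.
near=> n => v.
have wn i : w i n != 0 by move: i; near: n.
(* Testing the perturbed matrix at [v i * w i n] clears the denominators [w i n * w j n]. *)
have := pert (fun i j => Phi i j n / (w i n * w j n)) _ (fun i => v i * w i n).
have -> : \sum_i \sum_j v i * w i n * (v j * w j n) * (Phi i j n / (w i n * w j n))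
   = \sum_i \sum_j v i * v j * Phi i j n.
  by apply: eq_bigr => i _; apply: eq_bigr => j _; field; rewrite !wn.
apply => i j.
have near_ij : forall ij : I * I,
    `|psi (w ij.1 \* w ij.2) - Phi ij.1 ij.2 n / (w ij.1 n * w ij.2 n)| <= e.
  by near: n.
exact: (near_ij (i, j)).
Unshelve. all: by end_near. Qed.

Lemma is_psd_gram d (N : 'M[R]_d) : is_psd N ->
  exists B : 'I_d -> 'I_d -> R, forall i j, N i j = \sum_l B i l * B j l.
Proof.
case: d N => [N _|d N [Nsym Npsd]]; first by exists (fun _ _ => 0) => -[].
have [||B BE] := @psd_gram R d.+1 (fun i j => N (inord i) (inord j)).
- by move=> i j; rewrite -{1}Nsym mxE.
- move=> v; have := Npsd (\col_i v i); rewrite !mxE.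
  under eq_bigr do rewrite !mxE mulr_suml.
  rewrite exchange_big/=; congr (0 <= _); apply: eq_bigr => i _.
  by apply: eq_bigr => j _; rewrite !mxE !inord_val mulrAC.
exists (fun i l => B i l) => i j.
by rewrite -(inord_val i) -(inord_val j) BE ?inord_val.
Qed.

Lemma is_psd_of_form d (N : 'M[R]_d) : N^T = N ->
  (forall v : 'I_d -> R, 0 <= \sum_i \sum_j v i * v j * N i j) -> is_psd N.
Proof.
move=> Nsym Npos; split=> // v; rewrite !mxE.
under eq_bigr do rewrite !mxE mulr_suml.
rewrite exchange_big/=; have := Npos (fun i => v i 0); congr (0 <= _).
by apply: eq_bigr => i _; apply: eq_bigr => j _; rewrite !mxE mulrAC.
Qed.

(** The germs [w] are those in which the Gram factor [B] of the lifted matrix expands. They are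
    produced before [psi] is given, so that [psi] can be adapted to their growth. *)
Lemma shadow_rescale (X : vectType R) (C : set X) (T : finType)
    (g : T -> nat -> R) (a : T -> X) (t1 : T) :
  spectrahedral_shadow C ->
  (forall t, nonzero U (g t)) ->
  (forall t t', g t = g t' \/ separated U (g t) (g t')) ->
  g t1 = (fun=> 1) ->
  (forall n, C (\sum_t g t n *: a t)) ->
  exists p (w : 'I_p -> nat -> R),
    [/\ forall i, nonzero U (w i),
        forall i j, i != j -> separated U (w i) (w j) &
        forall psi : (nat -> R) -> R,
          (forall f h, comparable U f h -> psi f = psi h) ->
          psi (fun=> 1) = 1 ->
          strongly_positive (fun i j => psi (w i \* w j)) ->
          \forall n \near U, C (\sum_t (psi (g t) * g t n) *: a t)].
Proof.
move=> [Y [d [M0 [M [d0 M0sym Msym ->]]]]] g0 gsep g1 Cg.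
have [y yP] : {y : nat -> Y &
    forall n, is_psd (M0 + M (\sum_t g t n *: a t, y n))} := choice Cg.
have [B BE] := choice (fun n => is_psd_gram (yP n)).
have [sw [[w0 wsep] wspan]] := extend_separated_fam
  (fun il : 'I_d * 'I_d => fun n => B n il.1 il.2) separated_nil.
rewrite /= in w0 wsep wspan.
exists (size sw), (fun i => nth 0 sw i); split=> // psi psiE psi1 psi_pos.
have [b bE] := choice wspan.
have [s0 [ss0 gs0]] := separated_undup g0 gsep.
(* Besides the [g t], which already lie in [s0], the germs to be expanded are the products of the
   [w i] and the coordinates of the lift [y n]. *)
pose f (j : ('I_(size sw) * 'I_(size sw)) + 'I_(\dim {:Y})) (n : nat) : R :=
  match j with
  | inl ij => nth 0 sw ij.1 n * nth 0 sw ij.2 n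
  | inr j => coord (vbasis {:Y}) j (y n)
  end.
have [s2 [[u0 usep] uspan]] := extend_separated_fam f ss0.
set s := s0 ++ s2 in u0 usep uspan.
have [c cE] := choice uspan.
have gs t : exists k : 'I_(size s), nth 0 s k = g t.
  have [k <-] := gs0 t.
  have ks : (k < size s)%N by rewrite size_cat (leq_trans (ltn_ord k))// leq_addr.
  by exists (Ordinal ks); rewrite nth_cat/= ltn_ord.
have [kap kapE] := choice gs.
pose e j := (vbasis {:Y})`_j.
(* The coefficient of the [k]-th germ in the linear matrix expression; the constant term [M0]
   belongs to the germ 1, that is to [g t1]. *)
pose P k : 'M[R]_d := \sum_(t | kap t == k) M (a t, 0)
  + (if kap t1 == k then M0 else 0) + \sum_(j < \dim {:Y}) c (inr j) k *: M (0, e j).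
have sumP z : \sum_k z k *: P k = z (kap t1) *: M0 + M (\sum_t z (kap t) *: a t,
    \sum_(j < \dim {:Y}) (\sum_(k < size s) c (inr j) k * z k) *: e j).
  have M_pair x1 y1 : M (x1, y1) = M (x1, 0) + M (0, y1).
    by rewrite -linearD; congr (M (_, _)); rewrite /= ?addr0 ?add0r.
  under eq_bigr do rewrite /P !scalerDr.
  rewrite !big_split/= M_pair addrA [X in X + _ = _]addrC -!addrA; congr (_ + (_ + _)).
  - rewrite (bigD1 (kap t1))//= eqxx big1 ?addr0// => k.
    by rewrite eq_sym => /negbTE ->; rewrite scaler0.
  - under eq_bigr do rewrite scaler_sumr.
    have -> : (\sum_t z (kap t) *: a t, 0 : Y) = \sum_t z (kap t) *: (a t, 0 : Y).
      elim/big_rec2: _ => // t y1 y2 _ <-.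
      by congr (_, _); rewrite /= scaler0 add0r.
    rewrite linear_sum (partition_big kap xpredT)//=; apply: eq_bigr => k _.
    by apply: eq_bigr => t /eqP ->; rewrite linearZ.
  - have -> : (0 : X, \sum_(j < \dim {:Y}) (\sum_(k < size s) c (inr j) k * z k) *: e
      j) =
        \sum_(j < \dim {:Y}) (\sum_(k < size s) c (inr j) k * z k) *: (0 : X, e j).
      elim/big_rec2: _ => // j y1 y2 _ <-.
      by congr (_, _); rewrite /= scaler0 add0r.
    rewrite linear_sum/=; under eq_bigr do rewrite scaler_sumr.
    rewrite exchange_big/=; apply: eq_bigr => j _.
    rewrite linearZ/= scaler_suml; apply: eq_bigr => k _.
    by rewrite scalerA mulrC.
(* The coefficient of the [k]-th germ in the product of [B] with its transpose. *)
pose Q (k : 'I_(size s)) (i j : 'I_d) :=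
  \sum_l \sum_(i' < size sw) \sum_(j' < size sw)
   b (i, l) i' * b (j, l) j' * c (inl (i', j')) k.
have QE z i j : \sum_k Q k i j * z k =
    \sum_l \sum_(i' < size sw) \sum_(j' < size sw) b (i, l) i' * b (j, l) j' *
      \sum_(k < size s) c (inl (i', j')) k * z k.
  under eq_bigr do rewrite mulr_suml.
  rewrite exchange_big/=; apply: eq_bigr => l _.
  under eq_bigr do rewrite mulr_suml.
  rewrite exchange_big/=; apply: eq_bigr => i' _.
  under eq_bigr do rewrite mulr_suml.
  rewrite exchange_big/=; apply: eq_bigr => j' _.
  by rewrite mulr_sumr; apply: eq_bigr => k _; rewrite mulrA.
(* Both sides are expansions of the same matrix, and separated germs are linearly independent. *)
have PQ i j k : P k i j = Q k i j.
  apply/eqP; rewrite -subr_eq0; apply/eqP.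
  apply: (separated_free (c := fun k => P k i j - Q k i j) u0 usep) => {k}.
  have near_b : \forall n \near U, forall il : 'I_d * 'I_d,
      B n il.1 il.2 = \sum_(k < size sw) b il k * nth 0 sw k n by exact: filter_forall.
  have near_c : \forall n \near U, forall j, f j n =
    \sum_(k < size s) c j k * nth 0 s k n.
    exact: filter_forall.
  apply: filterS (filterI near_b near_c) => n [nb nc].
  under eq_bigr do rewrite mulrBl.
  rewrite sumrB; apply/eqP; rewrite subr_eq0; apply/eqP.
  have -> : \sum_(k < size s) P k i j * nth 0 s k n =
      (\sum_(k < size s) nth 0 s k n *: P k) i j.
    by rewrite summxE; apply: eq_bigr => k _; rewrite !mxE mulrC.
  rewrite sumP kapE g1 scale1r.
  under [X in M (X, _)]eq_bigr do rewrite kapE.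
  have -> : \sum_(j < \dim {:Y}) (\sum_(k < size s) c (inr j) k * nth 0 s k n) *: e j
    = y n.
    rewrite [RHS](coord_vbasis (memvf _)).
    by apply: eq_bigr => j' _; rewrite -(nc (inr j')).
  rewrite BE QE; apply: eq_bigr => l _.
  rewrite (nb (i, l)) (nb (j, l)) big_distrlr/=.
  apply: eq_bigr => i' _; apply: eq_bigr => j' _.
  by rewrite -(nc (inl (i', j')))/=; ring.
have := rescale_gram w0 u0 usep (fun i j => cE (inl (i, j))) psiE psi_pos.
apply: filterS => n gram_ge0.
(* The new lift is [y n] with its expansion rescaled term by term by the same factors. *)
exists (\sum_(j < \dim {:Y})
  (\sum_(k < size s) c (inr j) k * (psi (nth 0 s k) * nth 0 s k n)) *: e j).
have := sumP (fun k => psi (nth 0 s k) * nth 0 s k n).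
rewrite kapE g1 psi1 mulr1 scale1r.
under [X in M (X, _)]eq_bigr do rewrite kapE.
move=> <-; apply: is_psd_of_form.
  rewrite linear_sum/=; apply: eq_bigr => k _; rewrite linearZ/=; congr (_ *: _).
  rewrite !linearD/= !linear_sum/=; congr (_ + _ + _).
  - by apply: eq_bigr => t _; rewrite Msym.
  - by case: ifP; rewrite ?M0sym ?trmx0.
  - by apply: eq_bigr => j _; rewrite linearZ/= Msym.
move=> v.
have -> : \sum_i \sum_j v i * v j *
      (\sum_(k < size s) psi (nth 0 s k) * nth 0 s k n *: P k) i j
    = \sum_l \sum_i \sum_j v i * v j * \sum_(i' < size sw) \sum_(j' < size sw) b (i,
      l) i' * b (j, l) j' *
      \sum_(k < size s) c (inl (i', j')) k * psi (nth 0 s k) * nth 0 s k n.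
  rewrite [RHS]exchange_big; apply: eq_bigr => i _.
  rewrite [RHS]exchange_big; apply: eq_bigr => j _.
  rewrite -mulr_sumr; congr (_ * _).
  rewrite summxE; under eq_bigr do rewrite mxE PQ mulrC.
  rewrite QE; do 3!apply: eq_bigr => ? _.
  by congr (_ * _); apply: eq_bigr => k _; rewrite mulrA.
apply: sumr_ge0 => l _; rewrite quadratic_form_substitute.
exact: gram_ge0.
Qed.

End Transfer.

(** * Exponents of germs *)

Section Exponents.
Context (R : realType) (U : set_system nat) {UU : UltraFilter U}.
Implicit Types (f h : nat -> R) (b : nat -> nat -> R).

Definition bounded_along f := exists M : R, \forall n \near U, `|f n| <= M.

Lemma bounded_along_eq f h : (\forall n \near U, f n = h n) ->
  bounded_along f -> bounded_along h.
Proof.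
by move=> fh [M fM]; exists M; apply: filterS (filterI fh fM) => n [<-].
Qed.

Lemma bounded_alongD f h : bounded_along f -> bounded_along h ->
  bounded_along (fun n => f n + h n).
Proof.
move=> [M fM] [M' hM]; exists (M + M').
by apply: filterS (filterI fM hM) => n [? ?]; rewrite (le_trans (ler_normD _ _))// lerD.
Qed.

Lemma bounded_alongZ (a : R) f : bounded_along f -> bounded_along (fun n => a * f n).
Proof.
move=> [M fM]; exists (`|a| * M).
by apply: filterS fM => n fM; rewrite normrM ler_wpM2l.
Qed.

Lemma bounded_alongB f h : bounded_along f -> bounded_along h ->
  bounded_along (fun n => f n - h n).
Proof.
move=> fb hb; apply: bounded_along_eq (bounded_alongD fb (bounded_alongZ (-1) hb)).
by apply: nearW => n; rewrite mulN1r.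
Qed.

(** Meant for logarithms: nonzero germs are comparable exactly when their logarithms differ by a
    bounded amount, so growth rates are vectors modulo bounded sequences. *)
Definition independent_mod_bounded m b := forall c : nat -> R,
  bounded_along (fun n => \sum_(k < m) c k * b k n) -> forall k, (k < m)%N -> c k = 0.

Lemma independent_extend m b h : independent_mod_bounded m b ->
  exists m' b', [/\ (m <= m')%N, forall k, (k < m)%N -> b' k = b k,
    independent_mod_bounded m' b' &
    exists c : nat -> R, bounded_along (fun n => h n - \sum_(k < m') c k * b' k n)].
Proof.
move=> mb.
have [[c cb]|/forallNP nc] := pselect (exists c : nat -> R,
    bounded_along (fun n => h n - \sum_(k < m) c k * b k n)).
  by exists m, b; split=> //; exists c.
pose b' k := if k == m then h else b k.
have b'E k : (k < m)%N -> b' k = b k by move=> km; rewrite /b' ltn_eqF.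
exists m.+1, b'; split=> //; last first.
  exists (fun k => (k == m)%:R).
  exists 0; apply: nearW => n.
  rewrite big_ord_recr/= eqxx mul1r big1 => [|i _]; last by rewrite ltn_eqF// mul0r.
  by rewrite add0r /b' eqxx subrr normr0.
move=> c; under eq_fun do rewrite big_ord_recr/= {2}/b' eqxx.
under eq_fun do under eq_bigr do rewrite b'E//.
have [cm0 cb|cm cb] := eqVneq (c m) 0.
  move=> k; rewrite ltnS leq_eqVlt => /predU1P[->//|]; apply: mb.
  apply: bounded_along_eq cb; apply: nearW => n.
  by rewrite cm0 mul0r addr0.
exfalso; apply: (nc (fun k => - c k / c m)).
apply: bounded_along_eq (bounded_alongZ (c m)^-1 cb); apply: nearW => n.
rewrite mulrDr mulKf// addrC; congr (_ + _).
by rewrite -sumrN mulr_sumr; apply: eq_bigr => i _; ring.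
Qed.

Lemma independent_extend_seq m b (hs : seq (nat -> R)) :
  independent_mod_bounded m b ->
  exists m' b', [/\ (m <= m')%N, forall k, (k < m)%N -> b' k = b k,
    independent_mod_bounded m' b' & forall i, (i < size hs)%N ->
    exists c : nat -> R, bounded_along (fun n => nth 0 hs i n - \sum_(k < m') c k *
      b' k n)].
Proof.
elim: hs m b => [|h hs IH] m b mb; first by exists m, b.
have [m1 [b1 [mm1 b1E mb1 [c cb]]]] := independent_extend h mb.
have [m2 [b2 [mm2 b2E mb2 cbs]]] := IH _ _ mb1.
exists m2, b2; split=> //; first exact: leq_trans mm2.
  by move=> k km; rewrite b2E ?b1E// (leq_trans km).
case=> [_|i] /=; last exact: cbs.
exists (fun k => if (k < m1)%N then c k else 0).
apply: bounded_along_eq cb; apply: nearW => n; congr (_ - _).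
rewrite (big_ord_widen m2 (fun k => c k * b1 k n))// big_mkcond/=.
by apply: eq_bigr => k _; case: ifP => [km|_]; rewrite ?mul0r// b2E.
Qed.

(** The shift of [n] gives positivity at [n = 0]; the shift of [k] makes the first member unbounded
    too. *)
Definition power_scale (k n : nat) : R := n.+1%:R ^+ k.+1.

Lemma power_scale_gt0 k n : 0 < power_scale k n.
Proof. by rewrite exprn_gt0. Qed.

Lemma harmonicX_cvg k : (@harmonic R n) ^+ k.+1 @[n --> \oo] --> 0.
Proof.
elim: k => [|k IH]; first by under eq_fun do rewrite expr1; exact: cvg_harmonic.
under eq_fun do rewrite exprS.
by rewrite -(mulr0 0); apply: cvgM => //; exact: cvg_harmonic.
Qed.

(** Divided by its dominant power, the combination tends to a nonzero coefficient; being bounded, it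
    would have to tend to 0. *)
Lemma independent_power_scale m : \oo `<=` U ->
  independent_mod_bounded m power_scale.
Proof.
move=> infU c [M cM] k km; apply/eqP/negPn/negP => ck.
have ps0 i : nonzero U (power_scale i).
  by apply: nearW => n; rewrite lt0r_neq0// power_scale_gt0.
have lt_sep i j : (i < j)%N -> negligible U (power_scale i) (power_scale j).
  move=> ij; apply: cvg_trans (cvg_app _ infU) _.
  have := @harmonicX_cvg (j - i).-1; rewrite prednK ?subn_gt0//.
  apply: cvg_trans; apply: near_eq_cvg; apply: nearW => n.
  rewrite /power_scale /harmonic/= exprVn.
  have n0 : n.+1%:R != 0 :> R by rewrite pnatr_eq0.
  rewrite -(subnK (ltnW ij)) -addnS exprD invfM mulrCA divff ?mulr1 ?expf_neq0//.
  by rewrite addnK.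
have [||k0 ck0 klim] :=
  @dominant_term R U _ 'I_m (fun i => power_scale i) (fun i => c i) (fun i => ps0 i).
- move=> i j; rewrite neq_ltn => /orP[]; [left|right]; exact: lt_sep.
- by exists (Ordinal km).
have := klim (fun i => c i) (fun _ => id) => {}klim.
move/eqP : ck0; apply; apply: (limit_unique klim).
have M0 : 0 <= M by have [n /(le_trans (normr_ge0 _))] := filter_ex cM.
apply/cvgr0Pnorm_lt => e e0.
have hlim : (@harmonic R n) * M @[n --> U] --> 0.
  rewrite -(mul0r M); apply: cvgMl; apply: cvg_trans (cvg_app _ infU) _.
  exact: cvg_harmonic.
have he : \forall n \near U, `|@harmonic R n * M| < e by exact: cvgr0_norm_lt.
apply: filterS (filterI cM he) => n [nM]; apply: le_lt_trans.
rewrite normrM normfV (ger0_norm (ltW (power_scale_gt0 _ _))).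
have hM : 0 <= harmonic n * M by rewrite mulr_ge0// harmonic_ge0.
rewrite (ger0_norm hM).
rewrite mulrC ler_pM// ?invr_ge0 ?(ltW (power_scale_gt0 _ _))//.
rewrite /harmonic/= lef_pV2 ?posrE ?power_scale_gt0// /power_scale exprS.
by rewrite ler_peMr// exprn_ege1// ler1n.
Qed.

Section FixedScale.
Context (m : nat) (b : nat -> nat -> R) (mb : independent_mod_bounded m b).
Implicit Types d : 'rV[R]_m.

Definition scale_log d n := \sum_(k < m) d 0 k * b k n.

(** [f] is, up to factors bounded away from 0 and infinity, the monomial with exponent vector [d] in
    the sequences [expR (b k n)]. *)
Definition has_exponent f d :=
  nonzero U f /\ bounded_along (fun n => ln `|f n| - scale_log d n).

Lemma scale_logD d d' n : scale_log (d + d') n = scale_log d n + scale_log d' n.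
Proof. by rewrite -big_split; apply: eq_bigr => k _; rewrite !mxE mulrDl. Qed.

Lemma scale_logB d d' n : scale_log (d - d') n = scale_log d n - scale_log d' n.
Proof. by rewrite -sumrB; apply: eq_bigr => k _; rewrite !mxE mulrBl. Qed.

Lemma bounded_scale_log d : bounded_along (scale_log d) -> d = 0.
Proof.
move=> db; apply/rowP => k; rewrite mxE.
pose c i := oapp (d 0) 0 (insub i).
have cE (i : 'I_m) : c i = d 0 i by rewrite /c valK.
rewrite -cE; apply: mb (ltn_ord k).
by apply: bounded_along_eq db; apply: nearW => n; apply: eq_bigr => j _; rewrite cE.
Qed.

Lemma has_exponent_expR d : has_exponent (fun n => expR (scale_log d n)) d.
Proof.
split; first by apply: nearW => n; rewrite lt0r_neq0// expR_gt0.
by exists 0; apply: nearW => n; rewrite (gtr0_norm (expR_gt0 _)) expRK subrr normr0.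
Qed.

Lemma has_exponentM f h d d' : has_exponent f d -> has_exponent h d' ->
  has_exponent (f \* h) (d + d').
Proof.
move=> [f0 fd] [h0 hd]; split.
  by apply: filterS (filterI f0 h0) => n [? ?]; rewrite mulf_neq0.
apply: bounded_along_eq (bounded_alongD fd hd).
apply: filterS (filterI f0 h0) => n [? ?].
rewrite normrM lnM ?posrE ?normr_gt0// scale_logD; ring.
Qed.

Lemma has_exponent_uniq f d d' : has_exponent f d -> has_exponent f d' -> d = d'.
Proof.
move=> [_ fd] [_ fd']; apply/eqP; rewrite -subr_eq0; apply/eqP/bounded_scale_log.
apply: bounded_along_eq (bounded_alongB fd' fd); apply: nearW => n.
by rewrite scale_logB; ring.
Qed.

Lemma comparable_bounded f h : nonzero U f -> comparable U f h ->
  nonzero U h /\ bounded_along (fun n => ln `|f n| - ln `|h n|).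
Proof.
move=> f0 [c c0 fhc].
have fh0 : \forall n \near U, f n / h n != 0 by exact: (cvgr_neq0 c).
have h0 : nonzero U h.
  by apply: filterS fh0 => n; rewrite mulf_eq0 invr_eq0 negb_or => /andP[].
split=> //.
have lim : ln `|f n / h n| @[n --> U] --> ln `|c|.
  apply: (@cvg_comp _ _ _ (fun n => `|f n / h n|) (@ln R) U (nbhs `|c|)).
    exact: cvg_norm.
  by apply: continuous_ln; rewrite normr_gt0.
exists (`|ln `|c| | + 1).
have dist : \forall n \near U, `|ln `|c| - ln `|f n / h n| | < 1.
  exact: cvgr_dist_lt.
apply: filterS (filterI dist (filterI f0 h0)) => n [cn [fn hn]].
rewrite -ln_div ?posrE ?normr_gt0// -normf_div ltW//.
rewrite -[X in `|X|](subrKC (ln `|c|)).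
by rewrite (le_lt_trans (ler_normD _ _))// ltrD2l distrC.
Qed.

(** By trichotomy: were one germ negligible to the other, the difference of logarithms would be
    unbounded. *)
Lemma bounded_comparable f h : nonzero U f -> nonzero U h ->
  bounded_along (fun n => ln `|f n| - ln `|h n|) -> comparable U f h.
Proof.
have neg f' h' : nonzero U f' -> nonzero U h' -> negligible U f' h' ->
    ~ bounded_along (fun n => ln `|f' n| - ln `|h' n|).
  move=> f0 h0 fh [M fhM].
  have lt : \forall n \near U, `|f' n / h' n| < expR (- M).
    by apply: cvgr0_norm_lt => //; exact: expR_gt0.
  have [n [[lt_n le_n] [fn hn]]] :=
    filter_ex (filterI (filterI lt fhM) (filterI f0 h0)).
  have fhn : 0 < `|f' n / h' n| by rewrite normr_gt0 mulf_neq0// invr_eq0.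
  move: le_n; rewrite -ln_div ?posrE ?normr_gt0// -normf_div ler_norml => /andP[le_n _].
  have : ln `|f' n / h' n| < ln (expR (- M)) by rewrite ltr_ln ?posrE ?expR_gt0.
  by rewrite expRK ltNge le_n.
move=> f0 h0 fhb; have [fh|hf|//] := negligible_or_comparable f0 h0.
  by case: (neg _ _ f0 h0 fh).
case: (neg _ _ h0 f0 hf); apply: bounded_along_eq (bounded_alongZ (-1) fhb).
by apply: nearW => n; rewrite mulN1r opprB.
Qed.

Lemma has_exponent_comparable f h d : comparable U f h ->
  has_exponent f d -> has_exponent h d.
Proof.
move=> fh [f0 fd]; have [h0 fhb] := comparable_bounded f0 fh; split=> //.
by apply: bounded_along_eq (bounded_alongB fd fhb); apply: nearW => n; ring.
Qed.

Lemma comparable_of_exponent f h d :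
  has_exponent f d -> has_exponent h d -> comparable U f h.
Proof.
move=> [f0 fd] [h0 hd]; apply: bounded_comparable => //.
by apply: bounded_along_eq (bounded_alongB fd hd); apply: nearW => n; ring.
Qed.

Lemma separated_of_exponent f h d d' : d != d' ->
  has_exponent f d -> has_exponent h d' -> separated U f h.
Proof.
move=> dd' fd hd; have [fh|hf|fh] := negligible_or_comparable fd.1 hd.1.
- by left.
- by right.
- move/eqP : dd'; case; apply: has_exponent_uniq hd.
  exact: has_exponent_comparable fd.
Qed.

End FixedScale.

End Exponents.

(** * Real powers of [t] and [1 + t] *)

Section PowerSums.
Context (R : realType).
Implicit Types (t : R).

Lemma is_derive_powR1p (a t : R) : 0 < t ->
  is_derive t 1 (fun t => (1 + t) `^ a) (a * (1 + t) `^ (a - 1)).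
Proof.
move=> t0; have t1 : 0 < 1 + t by rewrite addr_gt0.
have d1 : is_derive t 1 (fun t : R => 1 + t) 1.
  have := is_deriveD (is_derive_cst (1 : R) t 1) (is_derive_id t 1).
  by rewrite add0r.
have := is_derive1_comp (is_derive1_powR a t1 : is_derive ((fun t => 1 + t) t) _ _ _)
  d1.
by rewrite mulr1.
Qed.

Lemma is_derive_powR_sum (I : Type) (s : seq I) (b h : I -> R) t : 0 < t ->
  is_derive t 1 (fun t => \sum_(i <- s) h i * (1 + t) `^ (b i))
    (\sum_(i <- s) h i * b i * (1 + t) `^ (b i - 1)).
Proof.
move=> t0; elim: s => [|i s IH].
  by under eq_fun do rewrite big_nil; rewrite big_nil; exact: is_derive_cst.
under eq_fun do rewrite big_cons; rewrite big_cons.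
apply: is_deriveD; rewrite -mulrA.
have := is_derive_powR1p (b i) t0 => d.
exact: is_deriveZ.
Qed.

Lemma powR1p_cvg (a : R) : (1 + t) `^ a @[t --> 0^'+] --> (1 : R).
Proof.
have c1 : {for 1, continuous (fun x : R => x `^ a)}.
  apply: differentiable_continuous; apply/derivable1_diffP.
  by have [] := is_derive1_powR a (ltr01 : 0 < 1 :> R).
have cvg1 : 1 + t @[t --> (0 : R)^'+] --> (1 : R).
  rewrite -[X in _ --> X]addr0; apply: cvgD; first exact: cvg_cst.
  exact: cvg_at_right_filter.
have e1 : 1 `^ a = 1 :> R by rewrite powR1.
rewrite -[X in _ --> X]e1.
apply: (@cvg_comp _ _ _ (fun t => 1 + t) (fun x : R => x `^ a) (0^'+) (nbhs (1 : R))).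
  exact: cvg1.
exact: c1.
Qed.

Lemma powR_sum_cvg (I : Type) (s : seq I) (b h : I -> R) :
  \sum_(i <- s) h i * (1 + t) `^ (b i) @[t --> 0^'+] --> \sum_(i <- s) h i.
Proof.
apply: cvg_big => //; first exact: add_continuous.
move=> i _; rewrite -[X in _ --> X]mulr1; apply: cvgM; first exact: cvg_cst.
exact: powR1p_cvg.
Qed.

(* By induction: divide by one of the powers, then differentiate. *)
Lemma powR_sum_order (I : eqType) (s : seq I) (b h : I -> R) :
  uniq s -> {in s &, injective b} -> (exists2 i, i \in s & h i != 0) ->
  exists k, exists2 q : R, q != 0 &
    (\sum_(i <- s) h i * (1 + t) `^ (b i)) / t ^+ k @[t --> 0^'+] --> q.
Proof.
elim: s b h => [|i0 s IH] b h; first by move=> _ _ [].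
move=> /= /andP[i0s us] binj [i1 i1s hi1].
pose G t := h i0 + \sum_(i <- s) h i * (1 + t) `^ (b i - b i0).
suff [k [q q0 Gq]] : exists k, exists2 q : R, q != 0 & G t / t ^+ k @[t --> 0^'+] --> q.
  exists k, q => //; rewrite -(mul1r q).
  apply: cvg_trans (cvgM (powR1p_cvg (b i0)) Gq); apply: near_eq_cvg; near=> t.
  have t1 : 1 + t != 0 by rewrite lt0r_neq0// addr_gt0.
  rewrite /= mulrA; congr (_ / _); rewrite big_cons /G mulrDr mulrC; congr (_ + _).
  rewrite mulr_sumr; apply: eq_bigr => i _.
  by rewrite mulrCA -powRD ?t1 ?implybT// subrKC.
have Gcvg : G t @[t --> 0^'+] --> h i0 + \sum_(i <- s) h i.
  by apply: cvgD; [exact: cvg_cst|exact: powR_sum_cvg].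
have [G0|G0] := eqVneq (h i0 + \sum_(i <- s) h i) 0; last first.
  exists 0%N, (h i0 + \sum_(i <- s) h i) => //.
  by under eq_fun do rewrite expr0 divr1.
rewrite G0 in Gcvg.
have [||k [q q0 dGq]] := IH (fun i => b i - b i0 - 1) (fun i => h i * (b i - b i0)) us.
- move=> i j is_ js /= /subIr/subIr; apply: binj; by rewrite inE ?is_ ?js orbT.
- have [i2 i2s hi2] : exists2 i, i \in s & h i != 0.
    move: i1s; rewrite inE => /predU1P[i1E|]; last by exists i1.
    apply: contrapT => /forall2NP hs; move: G0; rewrite big_seq big1.
      by rewrite addr0 -i1E => /eqP; rewrite (negbTE hi1).
    by move=> i is_; case: (hs i) => // /negP/negPn/eqP.
  exists i2 => //; rewrite mulf_neq0// subr_eq0; apply/eqP => /binj.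
  rewrite !inE i2s eqxx orbT => /(_ isT isT) i20.
  by rewrite -i20 i2s in i0s.
exists k.+1, (q / k.+1%:R); first by rewrite mulf_neq0// invr_eq0 pnatr_eq0.
pose dG t := \sum_(i <- s) h i * (b i - b i0) * (1 + t) `^ (b i - b i0 - 1).
apply: (@lhopital_at_right R G dG (fun t => t ^+ k.+1) (fun t => k.+1%:R * t ^+ k) 0
  1) => //.
- move=> t; rewrite in_itv/= => /andP[t0 _].
  have := is_deriveD (is_derive_cst (h i0) t 1)
    (is_derive_powR_sum s (fun i => b i - b i0) h t0).
  by rewrite add0r.
- move=> t _.
  have -> : (fun t => t ^+ k.+1) = id ^+ k.+1 :> (R -> R).
    by apply/funext => x; rewrite exprfctE.
  have := is_deriveX k.+1 (is_derive_id t (1 : R)).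
  by rewrite /= /GRing.scale/= mulr1.
- have e0 : 0 ^+ k.+1 = 0 :> R by rewrite expr0n.
  rewrite -[X in _ --> X]e0.
  by apply: (@cvg_at_right_filter _ _ (fun t => t ^+ k.+1)); exact: exprn_continuous.
- by move=> t; rewrite in_itv/= => /andP[t0 _];
    rewrite mulf_neq0 ?pnatr_eq0// expf_neq0// lt0r_neq0.
apply: cvg_trans (cvgM dGq (cvg_cst (k.+1%:R^-1 : R))); apply: near_eq_cvg.
apply: nearW => t /=; rewrite -/(dG t) invfM mulrA mulrAC.
Unshelve. all: by end_near. Qed.

Definition has_order (F : R -> R) (e : R) :=
  exists2 q : R, q != 0 & F t / t `^ e @[t --> 0^'+] --> q.

Lemma has_order_add F G e e' : has_order F e -> has_order G e' -> e < e' ->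
  has_order (F \+ G) e.
Proof.
move=> [q q0 Fq] [q' _ Gq] ee'; exists q => //.
have {1}-> : q = q + q' * 0 by rewrite mulr0 addr0.
have d0 : 0 < e' - e by rewrite subr_gt0.
apply: cvg_trans (cvgD Fq (cvgM Gq (powR_cvg0 d0))); apply: near_eq_cvg; near=> t => /=.
rewrite mulrDl; congr (_ + _).
have t0 : t != 0 by rewrite lt0r_neq0.
rewrite -[LHS]/(G t / t `^ e' * t `^ (e' - e)) powRB ?t0 ?implybT// mulrA;
  congr (_ / _).
by rewrite mulfVK// lt0r_neq0// powR_gt0.
Unshelve. all: by end_near. Qed.

(** Distinct [c] in [0, 1) make the orders [c + k c] distinct, so nothing cancels and the lowest
    order survives in the sum. *)
Lemma fractional_orders_sum (cs : seq R) (g : R -> R -> R) (k : R -> nat) :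
  uniq cs -> (forall c, c \in cs -> 0 <= c < 1) -> cs != [::] ->
  (forall c, c \in cs -> has_order (g c) (c + (k c)%:R)) ->
  exists2 c, c \in cs & has_order (fun t => \sum_(c <- cs) g c t) (c + (k c)%:R).
Proof.
elim: cs => [//|c [|c' cs] IH].
  move=> _ _ _ ord; exists c; first by rewrite mem_head.
  by under eq_fun do rewrite big_seq1; apply: ord; rewrite mem_head.
move=> /andP[ccs us] c01 _ ord.
have [x xs|//|x xs|d ds dord] := IH us.
- by apply: c01; rewrite inE xs orbT.
- by apply: ord; rewrite inE xs orbT.
have cord := ord c (mem_head _ _).
have /andP[c0 c1] := c01 c (mem_head _ _).
have /andP[d0 d1] : 0 <= d < 1 by apply: c01; rewrite inE ds orbT.
have sumE : (fun t => \sum_(x <- c :: c' :: cs) g x t) =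
    g c \+ (fun t => \sum_(x <- c' :: cs) g x t).
  by apply/funext => t /=; rewrite big_cons.
rewrite sumE; have [lt|gt|eq] := ltgtP (c + (k c)%:R) (d + (k d)%:R).
- exists c; first by rewrite mem_head.
  exact: has_order_add cord dord lt.
- exists d; first by rewrite inE ds orbT.
  have -> : g c \+ (fun t => \sum_(x <- c' :: cs) g x t) =
      (fun t => \sum_(x <- c' :: cs) g x t) \+ g c by apply/funext => t /=;
        rewrite addrC.
  exact: has_order_add dord cord gt.
- exfalso; suff cd : c = d by rewrite cd ds in ccs.
  have kE : k c = k d.
    have lt1 (x y z w : R) : x + z = y + w -> y < 1 -> 0 <= x -> z < w + 1.
      move=> xzyw y1 x0; have -> : z = y + w - x by rewrite -xzyw addrAC subrr add0r.
      by rewrite addrAC addrC ltrD2l; apply: le_lt_trans y1; rewrite gerBl.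
    apply/eqP; rewrite eqn_leq -[(k c <= _)%N]ltnS -[(k d <= _)%N]ltnS -!(ltr_nat R)
      -!natr1.
    by rewrite (lt1 _ _ _ _ eq)// (lt1 _ _ _ _ (esym eq)).
  by move: eq; rewrite kE => /addIr.
Qed.

(** Group the terms with nonzero coefficient by the exponent [c] of [t]. At [t = 0] each group has
    an order in [c] plus the naturals, so the total has an order as well and cannot vanish. *)
Lemma powR_monomials_free (s : seq (R * R)) (f : R * R -> R) : uniq s ->
  (forall p, p \in s -> 0 <= p.2 < 1) ->
  (forall t, 0 < t -> \sum_(p <- s) f p * (t `^ p.2 * (1 + t) `^ p.1) = 0) ->
  forall p, p \in s -> f p = 0.
Proof.
move=> us s01 sum0 p0 p0s; apply/eqP/negPn/negP => fp0.
pose s1 := [seq p <- s | f p != 0]; pose cs := undup [seq p.2 | p <- s1].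
have us1 : uniq s1 by exact: filter_uniq.
pose g c t := \sum_(p <- s1 | p.2 == c) f p * (1 + t) `^ p.1.
have gord c : c \in cs -> exists k : nat, has_order (fun t => t `^ c * g c t) (c +
  k%:R).
  rewrite mem_undup => /mapP[p ps1 cE].
  have [||k [q q0 gq]] :=
    @powR_sum_order _ [seq p <- s1 | p.2 == c] fst f (filter_uniq _ us1).
  - move=> [x1 x2] [y1 y2]; rewrite !mem_filter/= => /andP[/eqP -> _] /andP[/eqP -> _].
    by move=> ->.
  - exists p; first by rewrite mem_filter -cE eqxx ps1.
    by move: ps1; rewrite mem_filter => /andP[].
  exists k, q => //; apply: cvg_trans gq; apply: near_eq_cvg; near=> t => /=.
  have t0 : 0 < t by [].
  rewrite powRD ?(lt0r_neq0 t0) ?implybT// powR_mulrn ?ltW// invfM mulrACA.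
  by rewrite divff ?mul1r ?big_filter// lt0r_neq0// powR_gt0.
have [k kP] : exists k : R -> nat,
    forall c, c \in cs -> has_order (fun t => t `^ c * g c t) (c + (k c)%:R).
  have kex c : exists k : nat, c \in cs -> has_order (fun t => t `^ c * g c t) (c +
    k%:R).
    by have [ccs|] := boolP (c \in cs); [have [k ?] := gord c ccs; exists k|exists 0%N].
  by have [k kP] := choice kex; exists k.
have p0s1 : p0 \in s1 by rewrite mem_filter fp0.
have [||c _ [q q0 lim]] := fractional_orders_sum (undup_uniq _) _ _ kP.
- move=> c; rewrite mem_undup => /mapP[p]; rewrite mem_filter => /andP[_ ps] ->.
  exact: s01.
- have : p0.2 \in cs by rewrite mem_undup map_f.
  by rewrite -/cs; apply: contraTneq => ->.
move/eqP : q0; apply; apply: (cvg_unique _ lim); first exact: Rhausdorff.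
apply: cvg_near_cst; near=> t.
have t0 : 0 < t by [].
suff -> : \sum_(c <- cs) t `^ c * g c t = 0 by rewrite mul0r.
rewrite -[RHS](sum0 t t0) (bigID (fun p => f p == 0))/= [X in _ = X + _]big1 ?add0r;
  last first.
  by move=> p /eqP ->; rewrite mul0r.
rewrite -[RHS]big_filter -/s1 /g.
under eq_bigr do rewrite big_mkcond mulr_sumr/=.
rewrite exchange_big/= [RHS]big_seq [LHS]big_seq; apply: eq_bigr => p ps1.
rewrite (bigD1_seq p.2) ?undup_uniq ?mem_undup ?map_f//= eqxx big1 ?addr0.
  by ring.
by move=> x; rewrite eq_sym => /negbTE ->; rewrite mulr0.
Unshelve. all: by end_near. Qed.

End PowerSums.

(** * Functionals positive on squares *)

Lemma seq_argmax (R : realType) (T : eqType) (F : T -> R) (s : seq T) x0 : x0 \in s ->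
  exists2 x, x \in s & forall y, y \in s -> F y <= F x.
Proof.
elim: s x0 => [//|a [|b s] IH] x0 _.
  by exists a; rewrite ?mem_head// => y; rewrite inE => /eqP ->.
have [x xs xmax] := IH b (mem_head _ _).
have [ax|xa] := leP (F a) (F x).
  exists x; first by rewrite inE xs orbT.
  by move=> y; rewrite inE => /predU1P[->//|/xmax].
exists a; first exact: mem_head.
by move=> y; rewrite inE => /predU1P[->//|/xmax/le_trans]; apply; exact: ltW.
Qed.

Section SeqForms.
Context (R : realType) (m : nat).
Implicit Types (D : seq 'rV[R]_m) (psi : 'rV[R]_m -> R) (g h : 'rV[R]_m).

(* The value at [F ^ 2], with [F = \sum_g f g *: x ^ g], of the linear functional
   [x ^ g |-> psi g]. *)
Definition hankel_form psi D (f : 'rV[R]_m -> R) :=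
  \sum_(g <- D) \sum_(h <- D) f g * f h * psi (g + h).

Definition hankel_positive psi D :=
  exists2 e, 0 < e & forall f, e * (\sum_(g <- D) f g ^+ 2) <= hankel_form psi D f.

Lemma perm_hankel_positive psi D D' : perm_eq D D' ->
  hankel_positive psi D -> hankel_positive psi D'.
Proof.
move=> DD' [e e0 eP]; exists e => // f.
have := eP f; rewrite (perm_big _ DD')/= /hankel_form (perm_big _ DD')/=.
by under [X in _ <= X]eq_bigr do rewrite (perm_big _ DD').
Qed.

(** Vertices of the convex hull of [D] have this property. *)
Definition midpoint_free D g :=
  forall h h', h \in D -> h' \in D -> h + h' = g + g -> h = g /\ h' = g.

(* [psi (g + g)] enters the form on [D] nowhere, so it can be made large. *)
Lemma hankel_positive_cons psi D g : uniq (g :: D) ->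
  hankel_positive psi D -> midpoint_free (g :: D) g ->
  exists psi', hankel_positive psi' (g :: D) /\
    forall a, a != g + g -> psi' a = psi a.
Proof.
move=> /= /andP[gD _] [e e0 eP] gfree.
pose B := \sum_(h <- D) psi (g + h) ^+ 2.
(* By completing squares, [2 / e * B] absorbs the cross terms at the cost of half of the old bound
   [e]; the summand [e / 2] gives the bound in the new direction. *)
pose psi' a := if a == g + g then 2 / e * B + e / 2 else psi a.
have psi'D h h' : h \in D -> h' \in g :: D -> psi' (h + h') = psi (h + h').
  move=> hD h'D; rewrite /psi' ifN//; apply/eqP => hh'.
  have [hg _] := gfree h h' (mem_behead (s := g :: D) hD) h'D hh'.
  by rewrite -hg hD in gD.
exists psi'; split; last by move=> a ag; rewrite /psi' (negbTE ag).
exists (e / 2); first by rewrite divr_gt0.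
move=> f; rewrite /hankel_form !big_cons.
have -> : psi' (g + g) = 2 / e * B + e / 2 by rewrite /psi' eqxx.
have -> : \sum_(h <- D) f g * f h * psi' (g + h) =
  f g * \sum_(h <- D) f h * psi (g + h).
  rewrite mulr_sumr big_seq [RHS]big_seq; apply: eq_bigr => h hD.
  by rewrite addrC psi'D ?mem_head// addrC mulrA.
have -> : \sum_(i <- D) \sum_(h <- g :: D) f i * f h * psi' (i + h) =
    f g * \sum_(h <- D) f h * psi (g + h) + hankel_form psi D f.
  rewrite mulr_sumr /hankel_form -big_split/= big_seq [RHS]big_seq.
  apply: eq_bigr => h hD; rewrite big_cons psi'D ?mem_head//; congr (_ + _).
    by rewrite [h + g]addrC; ring.
  by rewrite big_seq [RHS]big_seq; apply: eq_bigr => h' h'D;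
    rewrite psi'D// inE h'D orbT.
have key : - (e / 2 * (\sum_(h <- D) f h ^+ 2) + 2 / e * f g ^+ 2 * B) <=
    2 * (f g * \sum_(h <- D) f h * psi (g + h)).
  rewrite /B !mulr_sumr -big_split/= -sumrN; apply: ler_sum => h _.
  have : 0 <= (e * f h + 2 * f g * psi (g + h)) ^+ 2 / (2 * e).
    by rewrite divr_ge0 ?sqr_ge0// mulr_ge0 ?ltW.
  rewrite -subr_ge0; congr (0 <= _); field.
  by rewrite lt0r_neq0.
have := eP f; set S := \sum_(h <- D) f h ^+ 2 in key *.
set T := \sum_(h <- D) _ in key *.
by move=> ePf; nra.
Qed.

Definition sqnorm g := \sum_k g 0 k ^+ 2.

Lemma sqnorm_eq0 g : sqnorm g <= 0 -> g = 0.
Proof.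
move=> g0; apply/rowP => k; rewrite mxE; apply/eqP;
  rewrite -sqrf_eq0 eq_le sqr_ge0 andbT.
apply: le_trans g0; rewrite /sqnorm (bigD1 k)//= lerDl.
by apply: sumr_ge0 => i _; exact: sqr_ge0.
Qed.

(* A maximizer of [lambda] of largest Euclidean norm is an extreme point. *)
Lemma extreme_exponent (lambda : 'rV[R]_m -> R) D g0 :
  {morph lambda : g h / g + h} -> g0 \in D ->
  exists2 g, g \in D & lambda g0 <= lambda g /\ midpoint_free D g.
Proof.
move=> lD g0D; have [g1 g1D g1max] := seq_argmax lambda g0D.
have [|g gD' gmax] := @seq_argmax R _ sqnorm [seq h <- D | lambda h == lambda g1] g1.
  by rewrite mem_filter eqxx.
move: gD'; rewrite mem_filter => /andP[/eqP lg gD].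
exists g; rewrite // lg; split; first exact: g1max.
move=> h h' hD h'D hh'.
have lhh' : lambda h + lambda h' = lambda g1 + lambda g1 by rewrite -lD hh' lD lg.
have lh : lambda h = lambda g1.
  by apply/eqP; rewrite eq_le g1max//=; have := g1max _ h'D; lra.
have lh' : lambda h' = lambda g1 by move: lhh'; rewrite lh => /addrI.
have nh : sqnorm h <= sqnorm g by apply: gmax; rewrite mem_filter lh eqxx.
have nh' : sqnorm h' <= sqnorm g by apply: gmax; rewrite mem_filter lh' eqxx.
have h'E : h' = g + g - h by rewrite -hh' addrAC subrr add0r.
(* Parallelogram law: [h] and [h'] are symmetric about [g] and neither is longer than [g], which
   forces [h = g]. *)
have para : sqnorm (h - g) *+ 2 = sqnorm h + sqnorm h' - sqnorm g *+ 2.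
  rewrite h'E /sqnorm -!sumrMnl -big_split -sumrB; apply: eq_bigr => k _ /=.
  by rewrite !mxE; ring.
have hg : h = g.
  apply/eqP; rewrite -subr_eq0; apply/eqP/sqnorm_eq0.
  by move: para; rewrite !mulr2n; lra.
by split=> //; rewrite h'E hg addrK.
Qed.

(** A midpoint-free exponent is taken out and put back by [hankel_positive_cons]. With the zero
    functional, [extreme_exponent] supplies an exponent of largest norm. *)
Lemma hankel_positive_exists D : uniq D -> exists psi, hankel_positive psi D.
Proof.
have [n] := ubnP (size D); elim: n D => // n IH [|g0 D'] nD uD.
  by exists (fun=> 0), 1 => // f; rewrite /hankel_form !big_nil mulr0.
set D := g0 :: D' in nD uD *.
pose zero (_ : 'rV[R]_m) : R := 0.
have l0 : {morph zero : g h / g + h} by move=> *; rewrite /zero addr0.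
have [g gD [_ gfree]] := extreme_exponent l0 (mem_head g0 D').
have gperm := perm_to_rem gD.
have [|psi psiD] := IH (rem g D) _ (rem_uniq _ uD).
  by rewrite size_rem//= ltnS in nD *; rewrite /= in nD.
have [||psi' [psi'D _]] := @hankel_positive_cons psi (rem g D) g _ psiD.
- by rewrite -(perm_uniq gperm).
- by move=> h h'; rewrite -!(perm_mem gperm); exact: gfree.
- by exists psi'; apply: perm_hankel_positive psi'D; rewrite perm_sym.
Qed.

End SeqForms.

(** Points are added while the rank grows, so finitely many of them span all [v y]; a vector outside
    this span is detected by a column of the [cokermx]. *)
Lemma span_of_separating (R : fieldType) (T : Type) n (v : T -> 'rV[R]_n) (w :
  'rV[R]_n) :
  (forall f : 'cV[R]_n, (forall x, v x *m f = 0) -> w *m f = 0) ->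
  exists q (x : 'I_q -> T) (a : 'I_q -> R), w = \sum_l a l *: v (x l).
Proof.
move=> wv.
have [q [x xP]] : exists q (x : 'I_q -> T), forall y, (v y <= \matrix_l v (x l))%MS.
  have max k : (exists q (x : 'I_q -> T), forall y, (v y <= \matrix_l v (x l))%MS) \/
      exists q (x : 'I_q -> T), (k <= \rank (\matrix_l v (x l)))%N.
    elim: k => [|k [?|[q [x xk]]]]; [|by left|].
      by right; exists 0%N, (fun i : 'I_0 => match notF (ltn_ord i) with end).
    have [xP|/existsNP[y yx]] := pselect (forall y, (v y <= \matrix_l v (x l))%MS).
      by left; exists q, x.
    right; exists (q + 1)%N, (fun l : 'I_(q + 1) => if fintype.split l is inl l' then
      x l' else y).
    apply: leq_ltn_trans xk _; apply: rank_ltmx; rewrite ltmxE.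
    have -> : \matrix_l v (if fintype.split l is inl l' then x l' else y) =
        col_mx (\matrix_l v (x l)) (v y).
      apply/row_matrixP => l; rewrite rowK; case: (split_ordP l) => l' ->.
        by rewrite rowKu rowK.
      by rewrite rowKd (ord1 l') row_id.
    rewrite -addsmxE addsmxSl/= -addsmxE addsmx_sub negb_and; apply/orP; right.
    exact/negP.
  case: (max n.+1) => [//|[q [x]]]; by rewrite ltnNge rank_leq_col.
have /submxP[a ->] : (w <= \matrix_l v (x l))%MS.
  rewrite submxE; apply/eqP/matrixP => i j; rewrite mxE.
  have /colP/(_ i) : w *m col j (cokermx (\matrix_l v (x l))) = 0.
    by apply: wv => y; have := xP y; rewrite submxE colE mulmxA => /eqP ->;
      rewrite mul0mx.
  by rewrite colE mulmxA -colE !mxE.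
exists q, x, (fun l => a 0 l); rewrite mulmx_sum_row.
by apply: eq_bigr => l _; rewrite rowK.
Qed.

(** * The Horn form *)

Section Horn.
Context (R : realType).

Definition horn (i j : 'I_5) : R := if (j == ordS i) || (i == ordS j) then -1 else 1.

Lemma hornC i j : horn i j = horn j i.
Proof. by rewrite /horn orbC. Qed.

Lemma big_ord5 (F : 'I_5 -> R) :
  \sum_i F i = F (inord 0) + F (inord 1) + F (inord 2) + F (inord 3) + F (inord 4).
Proof.
rewrite !big_ord_recr big_ord0/= add0r.
by do !congr (_ + _); congr F; apply: val_inj; rewrite /= inordK.
Qed.

Lemma hornE (a b : nat) : (a < 5)%N -> (b < 5)%N ->
  horn (inord a) (inord b) =
  if (b == a.+1 %% 5)%N || (a == b.+1 %% 5)%N then -1 else 1.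
Proof. by move=> a5 b5; rewrite /horn -!val_eqE /= !inordK. Qed.

Lemma horn_form (x : 'I_5 -> R) :
  \sum_i \sum_j horn i j * (x i * x j) =
  (x (inord 0) - x (inord 1) + x (inord 2) + x (inord 3) - x (inord 4)) ^+ 2
  + 4 * x (inord 1) * x (inord 3) + 4 * x (inord 2) * (x (inord 4) - x (inord 3)).
Proof. by rewrite !big_ord5 !hornE//=; ring. Qed.

(** [horn_form] settles the case [x_3 <= x_4]; a second identity of the same kind settles the
    other. *)
Lemma horn_copositive (x : 'I_5 -> R) : (forall i, 0 <= x i) ->
  0 <= \sum_i \sum_j horn i j * (x i * x j).
Proof.
move=> x0; rewrite horn_form.
have := x0 (inord 0); have := x0 (inord 1); have := x0 (inord 2).
have := x0 (inord 3); have := x0 (inord 4).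
move: (x (inord 0)) (x (inord 1)) (x (inord 2)) (x (inord 3)) (x (inord 4)).
move=> a b c d e e0 d0 c0 b0 a0.
have [de|ed] := leP d e.
  rewrite !addr_ge0 ?sqr_ge0// !mulr_ge0// ?subr_ge0//.
have -> : (a - b + c + d - e) ^+ 2 + 4 * b * d + 4 * c * (e - d) =
  (a - b + c - d + e) ^+ 2 + 4 * b * e + 4 * a * (d - e) by ring.
by rewrite !addr_ge0 ?sqr_ge0// !mulr_ge0// ?subr_ge0// ltW.
Qed.

(** For [t >= 0], the zeros of the Horn form on the face [{i, i+1, i+2}], where
    [y_(i+1) = y_i + y_(i+2)], normalised by [y_i = 1]. *)
Definition face_point (i : 'I_5) (t : R) (k : 'I_5) : R :=
  if k == i then 1 else if k == ordS i then 1 + t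
  else if k == ordS (ordS i) then t else 0.

Lemma ordS_inord (a : nat) : (a < 5)%N -> ordS (inord a : 'I_5) = inord (a.+1 %% 5).
Proof. by move=> a5; apply: val_inj; rewrite /= !inordK// ltn_pmod. Qed.

Lemma horn_face_point i t :
  \sum_j \sum_k horn j k * (face_point i t j * face_point i t k) = 0.
Proof.
have inordE (a b : nat) : (a < 5)%N -> (b < 5)%N -> (inord a == inord b :> 'I_5) =
  (a == b).
  by move=> a5 b5; rewrite -val_eqE /= !inordK.
rewrite horn_form /face_point -(inord_val i).
by case: i => -[|[|[|[|[|//]]]]] ? /=; rewrite !ordS_inord//= !inordE//=; ring.
Qed.

(** The sign flips at each step around a cycle of odd length. *)
Lemma cyclic_antisymmetric (F : 'I_5 -> R) :
  (forall i, F (ordS i) + F (ordS (ordS i)) = 0) -> F 0 = 0.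
Proof.
move=> FS.
have := FS (inord 0); have := FS (inord 1); have := FS (inord 2).
have := FS (inord 3); have := FS (inord 4); rewrite !ordS_inord//=.
have -> : F 0 = F (inord 0) by congr F; apply: val_inj; rewrite /= inordK.
by move=> *; lra.
Qed.

(** * Monomials with real exponents *)

Section Monomials.
Context (m' : nat).
Notation E := ('rV[R]_(5 + m')).
Implicit Types (g h : E) (P : 'I_5 -> R).

(** The first five coordinates of an exponent belong to [x_0, ..., x_4], the other [m'] to the
    growth rates adjoined later. *)
Definition unit_exponent (i : 'I_5) : E := delta_mx 0 (lshift m' i).

Definition degree g : R := \sum_(i < 5) g 0 (lshift m' i).

Definition monomial P g : R := \prod_(i < 5) P i `^ g 0 (lshift m' i).

(* Half the Newton polytope of [1 + sum_ij y_i y_j] in the first five variables. *)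
Definition simplex g := [/\ forall k : 'I_m', g 0 (rshift 5 k) = 0,
  forall i : 'I_5, 0 <= g 0 (lshift m' i) & degree g <= 1].

Lemma unit_exponentE i j : unit_exponent i 0 (lshift m' j) = (j == i)%:R.
Proof. by rewrite mxE eqxx/= (inj_eq (@lshift_inj _ _)). Qed.

Lemma unit_exponent_rshift i k : unit_exponent i 0 (rshift 5 k) = 0.
Proof. by rewrite mxE eqxx/= eq_rlshift. Qed.

Lemma degreeD g h : degree (g + h) = degree g + degree h.
Proof. by rewrite -big_split; apply: eq_bigr => i _; rewrite mxE. Qed.

Lemma degree_unit i : degree (unit_exponent i) = 1.
Proof.
rewrite /degree (bigD1 i)//= unit_exponentE eqxx big1 ?addr0// => j ji.
by rewrite unit_exponentE (negbTE ji).
Qed.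

Lemma simplex_unit i : simplex (unit_exponent i).
Proof.
split=> [k|j|]; first by rewrite unit_exponent_rshift.
  by rewrite unit_exponentE ler0n.
by rewrite degree_unit.
Qed.

Lemma exponentP g h : (forall i, g 0 (lshift m' i) = h 0 (lshift m' i)) ->
  (forall k, g 0 (rshift 5 k) = h 0 (rshift 5 k)) -> g = h.
Proof. by move=> gl gr; apply/rowP => k; case: (split_ordP k) => l ->. Qed.

Lemma simplex_vertex g i : simplex g -> 1 <= g 0 (lshift m' i) -> g = unit_exponent i.
Proof.
move=> [gr g0 dg] gi.
have := dg; rewrite /degree (bigD1 i)//= => dg'.
have gj j : j != i -> g 0 (lshift m' j) = 0.
  move=> ji; apply/eqP; rewrite eq_le g0 andbT.
  move: dg'; rewrite (bigD1 j)//= => dg'.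
  have : 0 <= \sum_(k < 5 | (k != i) && (k != j)) g 0 (lshift m' k).
    by apply: sumr_ge0 => k _; exact: g0.
  by move=> s0; lra.
apply: exponentP => [j|k]; last by rewrite gr unit_exponent_rshift.
rewrite unit_exponentE; have [->|ji] := eqVneq j i; last exact: gj.
rewrite mulr1n; apply/eqP; rewrite eq_le gi andbT.
have : 0 <= \sum_(k < 5 | k != i) g 0 (lshift m' k) by apply: sumr_ge0.
by move=> s0; lra.
Qed.

(** Nonnegative exponents matter where [P i = 0]: opposite exponents would cancel to 0 to the power
    0, which is 1, while the product is 0. *)
Lemma monomialD P g h :
  (forall i, 0 <= g 0 (lshift m' i)) -> (forall i, 0 <= h 0 (lshift m' i)) ->
  monomial P (g + h) = monomial P g * monomial P h.
Proof.
move=> g0 h0; rewrite -big_split; apply: eq_bigr => i _; rewrite mxE/=.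
have [gh0|gh0] := eqVneq (g 0 (lshift m' i) + h 0 (lshift m' i)) 0.
  move/eqP : gh0; rewrite paddr_eq0// => /andP[/eqP -> /eqP ->].
  by rewrite addr0 !powRr0 mulr1.
by rewrite powRD// (negbTE gh0).
Qed.

Lemma monomial_unit P i : (forall j, 0 <= P j) -> monomial P (unit_exponent i) = P i.
Proof.
move=> P0; rewrite /monomial (bigD1 i)//= unit_exponentE eqxx powRr1// big1 ?mulr1//
  => j ji.
by rewrite unit_exponentE (negbTE ji) powRr0.
Qed.

Lemma face_point_ge0 i t k : 0 <= t -> 0 <= face_point i t k.
Proof. by move=> t0; rewrite /face_point; do !case: ifP => // _; rewrite addr_ge0. Qed.

End Monomials.
End Horn.

(** * Linear relations between monomials on a face *)

Section HornFunctional.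
Context (R : realType) (m' : nat).
Notation E := ('rV[R]_(5 + m')).
Notation ue := (unit_exponent R m').
Implicit Types (D : seq E) (f : E -> R) (i : 'I_5).

Lemma ordS_neq i : [/\ ordS i != i, ordS (ordS i) != i & ordS (ordS i) != ordS i].
Proof. by case: i => -[|[|[|[|[|//]]]]] ?. Qed.

Definition on_face i (g : E) :=
  [forall k, (k \notin [:: i; ordS i; ordS (ordS i)]) ==> (g 0 (lshift m' k) == 0)].

Lemma on_faceP i (g : E) k : on_face i g -> k != i -> k != ordS i ->
  k != ordS (ordS i) -> g 0 (lshift m' k) = 0.
Proof.
move=> /forallP/(_ k)/implyP gk k0 k1 k2; apply/eqP/gk.
by rewrite !inE !negb_or k0 k1.
Qed.

Lemma monomial_face_point i t (g : E) : 0 < t ->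
  monomial (face_point i t) g = if on_face i g
    then t `^ g 0 (lshift m' (ordS (ordS i))) * (1 + t) `^ g 0 (lshift m' (ordS i))
    else 0.
Proof.
move=> t0; have [i1 i2 i12] := ordS_neq i; case: ifPn => [gi|].
  rewrite /monomial (bigD1 i)//= (bigD1 (ordS i))//= (bigD1 (ordS (ordS i)))/=;
    last first.
    by rewrite i2 i12.
  rewrite big1 => [|k /andP[/andP[k0 k1] k2]].
    rewrite /face_point !eqxx (negbTE i1) (negbTE i2) (negbTE i12) mulr1.
    by rewrite powR1 mul1r mulrC.
  by rewrite (on_faceP gi k0 k1 k2) powRr0.
rewrite negb_forall => /existsP[k]; rewrite negb_imply !inE !negb_or.
move=> /andP[/and3P[k0 k1 k2] gk].
rewrite /monomial (bigD1 k)//= /face_point (negbTE k0) (negbTE k1) (negbTE k2).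
by rewrite powR0 ?mul0r.
Qed.

(* Among [t ^ c * (1 + t) ^ b], with [b, c >= 0] and [b + c <= 1], the only
   linear relation is [t = (1 + t) - 1]. *)
Lemma face_relation D f i : uniq D -> (forall g, g \in D -> simplex g) ->
  (forall j, ue j \in D) ->
  (forall t, 0 < t ->
     \sum_(g <- D | degree g == 1) f g * monomial (face_point i t) g = 0) ->
  f (ue (ordS i)) + f (ue (ordS (ordS i))) = 0.
Proof.
move=> uD simD ueD sum0; have [i1 i2 i12] := ordS_neq i.
pose Di := [seq g <- D | (degree g == 1) && on_face i g].
have uDi : uniq Di by exact: filter_uniq.
have ueDi j : j \in [:: i; ordS i; ordS (ordS i)] -> ue j \in Di.
  move=> jf; rewrite mem_filter ueD degree_unit eqxx/= andbT.
  apply/forallP => k; apply/implyP => kf; rewrite unit_exponentE.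
  by rewrite (_ : k == j = false)//; apply: contraNF kf => /eqP ->.
pose pr (g : E) := (g 0 (lshift m' (ordS i)), g 0 (lshift m' (ordS (ordS i)))).
(* Recovers an exponent of degree 1 on the face from its last two coordinates. *)
pose q (x : R * R) : E := (1 - x.1 - x.2) *: ue i + x.1 *: ue (ordS i)
  + x.2 *: ue (ordS (ordS i)).
have prK g : g \in Di -> q (pr g) = g.
  rewrite mem_filter => /andP[/andP[/eqP dg gf] gD].
  have [gr _ _] := simD _ gD.
  have dg' : 1 - g 0 (lshift m' (ordS i)) - g 0 (lshift m' (ordS (ordS i)))
      = g 0 (lshift m' i).
    rewrite -dg /degree (bigD1 i)//= (bigD1 (ordS i))//= (bigD1 (ordS (ordS i)))/=;
      last first.
      by rewrite i2 i12.
    rewrite big1 => [|k /andP[/andP[k0 k1] k2]]; first by ring.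
    exact: on_faceP gf k0 k1 k2.
  have lin3 (u v w : E) a b c k :
      (a *: u + b *: v + c *: w) 0 k = a * u 0 k + b * v 0 k + c * w 0 k.
    by rewrite !mxE.
  apply: exponentP => [j|k]; rewrite lin3; last first.
    by rewrite gr !unit_exponent_rshift !mulr0 !addr0.
  rewrite /= dg' !unit_exponentE.
  have [->|j0] := eqVneq j i.
    by rewrite ![i == _]eq_sym (negbTE i1) (negbTE i2) mulr1 !mulr0 !addr0.
  have [->|j1] := eqVneq j (ordS i).
    by rewrite [_ == ordS (ordS i)]eq_sym (negbTE i12) mulr0 mulr1 mulr0 addr0 add0r.
  have [->|j2] := eqVneq j (ordS (ordS i)); first by rewrite !mulr0 !add0r mulr1.
  by rewrite (on_faceP gf j0 j1 j2) !mulr0 !addr0.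
pose e2 := ue (ordS (ordS i)).
(* [e2] is left out: its pair is (0, 1), while [powR_monomials_free] wants exponents of [t] below
   1. *)
pose s := [seq pr g | g <- rem e2 Di].
have e2Di : e2 \in Di by apply: ueDi; rewrite !inE eqxx !orbT.
have memr g : (g \in rem e2 Di) = (g != e2) && (g \in Di).
  by rewrite mem_rem_uniq// inE.
have us : uniq s.
  rewrite map_inj_in_uniq ?rem_uniq// => g h; rewrite !memr => /andP[_ gD] /andP[_ hD].
  by move=> /(congr1 q); rewrite !prK.
have s01 x : x \in s -> 0 <= x.2 < 1.
  move=> /mapP[g]; rewrite memr => /andP[ge2 gDi] -> /=.
  have gD : g \in D by move: gDi; rewrite mem_filter => /andP[].
  have [_ g0 _] := simD _ gD; rewrite g0/= ltNge; apply: contra ge2 => g2.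
  apply/eqP; apply: simplex_vertex g2. exact: simD.
have pr_i : pr (ue i) = (0, 0).
  by rewrite /pr !unit_exponentE (negbTE i1) (negbTE i2).
have pr_i1 : pr (ue (ordS i)) = (1, 0).
  by rewrite /pr !unit_exponentE eqxx (negbTE i12).
have ue_inj j k : j != k -> ue j != ue k.
  apply: contraNneq => /rowP/(_ (lshift m' j)); rewrite !unit_exponentE eqxx.
  by case: (j == k) => // /eqP; rewrite oner_eq0.
have s_i : (0, 0) \in s.
  by rewrite -pr_i map_f// memr ue_inj 1?eq_sym//= ueDi// inE eqxx.
have s_i1 : (1, 0) \in s.
  by rewrite -pr_i1 map_f// memr ue_inj 1?eq_sym//= ueDi// !inE eqxx orbT.
(* The term [f e2 * t] is rewritten as [f e2 * (1 + t) - f e2] and moved to the pairs (1, 0) and (0,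
   0). *)
pose f' x := f (q x) - (x == (0, 0))%:R * f e2 + (x == (1, 0))%:R * f e2.
have f'0 : f' (1, 0) = 0.
  apply: (powR_monomials_free us s01 _ s_i1) => t t0.
  have pick a (G : R * R -> R) : a \in s ->
      \sum_(x <- s) (x == a)%:R * f e2 * G x = f e2 * G a.
    move=> as_; rewrite (bigD1_seq a)//= eqxx mul1r big1 ?addr0// => x /negbTE ->.
    by rewrite !mul0r.
  rewrite /f'; under eq_bigr do rewrite mulrDl mulrBl.
  rewrite big_split/= sumrB !pick//= powRr0 powRr1 ?addr_ge0 ?ltW//.
  have := sum0 t t0.
  have -> : \sum_(g <- D | degree g == 1) f g * monomial (face_point i t) g
      = \sum_(g <- Di) f g * monomial (face_point i t) g.
    rewrite big_filter_cond/= [LHS](bigID (on_face i))/= [X in _ + X]big1 ?addr0//.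
      by apply: eq_bigl => g; rewrite andbT.
    by move=> g /andP[_ gf]; rewrite monomial_face_point// (negbTE gf) mulr0.
  rewrite (perm_big _ (perm_to_rem e2Di)) big_cons/=.
  have -> : monomial (face_point i t) e2 = t.
    rewrite monomial_unit; last by move=> j; exact/face_point_ge0/ltW.
    by rewrite /face_point (negbTE i2) (negbTE i12) eqxx.
  have -> : \sum_(g <- rem e2 Di) f g * monomial (face_point i t) g =
      \sum_(x <- s) f (q x) * (t `^ x.2 * (1 + t) `^ x.1).
    rewrite big_map big_seq [RHS]big_seq; apply: eq_bigr => g.
    rewrite memr => /andP[_ gDi]; rewrite prK//= monomial_face_point//.
    by move: gDi; rewrite mem_filter => /andP[/andP[_ ->]].
  by rewrite powRr0; lra.
move: f'0; rewrite /f' -{1}pr_i1 prK; last by apply: ueDi; rewrite !inE eqxx orbT.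
rewrite eqxx mul1r -pair_eqE /pair_eq/= oner_eq0/= mul0r subr0.
by [].
Qed.

End HornFunctional.

(** * A functional positive on squares and negative on the Horn form *)

Section HornSeparation.
Context (R : realType) (m' : nat).
Notation E := ('rV[R]_(5 + m')).
Notation ue := (unit_exponent R m').
Implicit Types (D : seq E) (f : E -> R) (i : 'I_5) (psi : E -> R).

Lemma vertex_relation D f : uniq D -> (forall g, g \in D -> simplex g) ->
  (forall j, ue j \in D) ->
  (forall i t, 0 < t ->
     \sum_(g <- D | degree g == 1) f g * monomial (face_point i t) g = 0) ->
  f (ue 0) = 0.
Proof.
move=> uD simD ueD sum0.
apply: (@cyclic_antisymmetric R (fun i => f (ue i))) => i.
exact: face_relation (sum0 i).
Qed.

(** By [vertex_relation], the coefficient at [ue 0] vanishes whenever all evaluations at face points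
    do; duality makes it a finite combination of them. [expR] parametrises [t > 0]. *)
Lemma vertex_atoms D : uniq D -> (forall g, g \in D -> simplex g) ->
  (forall j, ue j \in D) ->
  exists q (x : 'I_q -> 'I_5 * R) (a : 'I_q -> R), forall f, f (ue 0) =
    \sum_l a l * \sum_(g <- D | degree g == 1)
      f g * monomial (face_point (x l).1 (expR (x l).2)) g.
Proof.
move=> uD simD ueD.
pose v (x : 'I_5 * R) : 'rV[R]_(size D) := \row_k
  if degree D`_k == 1 then monomial (face_point x.1 (expR x.2)) D`_k else 0.
pose w : 'rV[R]_(size D) := \row_k (D`_k == ue 0)%:R.
have vE x f : v x *m (\col_k f D`_k) = (\sum_(g <- D | degree g == 1)
    f g * monomial (face_point x.1 (expR x.2)) g)%:M.
  apply/rowP => k; rewrite ord1 !mxE eqxx mulr1n [RHS]big_mkcond [RHS](big_nth 0)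
    [RHS]big_mkord.
  by apply: eq_bigr => l _; rewrite !mxE; case: ifP; rewrite ?mul0r// mulrC.
have wE f : w *m (\col_k f D`_k) = (f (ue 0))%:M.
  apply/rowP => k; rewrite ord1 !mxE eqxx mulr1n.
  have := ueD 0; rewrite -index_mem => uk.
  rewrite (bigD1 (Ordinal uk))//= big1 ?addr0 => [|l lk]; rewrite !mxE.
    by rewrite /= nth_index// eqxx mul1r.
  rewrite (_ : _ == _ = false) ?mul0r//; apply: contraNF lk => /eqP lk.
  by rewrite -val_eqE /= -lk index_uniq.
have [|q [x [a wva]]] := @span_of_separating R _ _ v w.
  move=> F vF; pose f g := \sum_(k < size D) (D`_k == g)%:R * F k 0.
  have fE : F = \col_k f D`_k.
    apply/colP => k; rewrite mxE /f (bigD1 k)//= eqxx mul1r big1 ?addr0// => l lk.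
    by rewrite nth_uniq// (negbTE (_ : l != k :> nat))// mul0r.
  rewrite fE wE (@vertex_relation D) ?raddf0// => i t t0.
  have := vF (i, ln t); rewrite fE vE/= lnK// => /matrixP/(_ 0 0).
  by rewrite !mxE eqxx mulr1n.
exists q, x, a => f.
have := wE f; rewrite wva mulmx_suml => /matrixP/(_ 0 0).
rewrite [in RHS]mxE eqxx mulr1n => <-; rewrite summxE; apply: eq_bigr => l _.
by rewrite -scalemxAl vE !mxE eqxx mulr1n.
Qed.

Lemma unit_exponent_inj : injective ue.
Proof.
move=> i j /rowP/(_ (lshift m' i)); rewrite !unit_exponentE eqxx => /eqP.
by case: (eqVneq i j) => // _; rewrite mulr1n mulr0n oner_eq0.
Qed.

Lemma simplex_le1 (g : E) i : simplex g -> g 0 (lshift m' i) <= 1.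
Proof.
move=> [_ g0]; apply: le_trans; rewrite /degree (bigD1 i)//= lerDl.
by apply: sumr_ge0.
Qed.

Lemma simplex_midpoint (g h : E) i : simplex g -> simplex h ->
  g + h = ue i + ue i -> g = ue i /\ h = ue i.
Proof.
move=> gs hs gh; have := congr1 (fun u : E => u 0 (lshift m' i)) gh.
rewrite /= [LHS]mxE [RHS]mxE !unit_exponentE eqxx => ghi.
have g1 := simplex_le1 i gs; have h1 := simplex_le1 i hs.
by split; apply: simplex_vertex => //; move: ghi; rewrite mulr1n; lra.
Qed.

Definition horn_value psi := \sum_i \sum_j horn R i j * psi (ue i + ue j).

Lemma sum_sqr_cauchy q (a F : 'I_q -> R) :
  (\sum_l a l * F l) ^+ 2 <= (1 + \sum_l a l ^+ 2) * \sum_l F l ^+ 2.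
Proof.
set A := \sum_l a l ^+ 2; set S := \sum_l F l ^+ 2; set T := \sum_l a l * F l.
have A0 : 0 <= A by apply: sumr_ge0 => l _; exact: sqr_ge0.
have S0 : 0 <= S by apply: sumr_ge0 => l _; exact: sqr_ge0.
have quad x : 0 <= x ^+ 2 * A - x *+ 2 * T + S.
  have -> : x ^+ 2 * A - x *+ 2 * T + S = \sum_l (x * a l - F l) ^+ 2.
    rewrite /A /S /T !mulr_sumr -sumrB -big_split/=; apply: eq_bigr => l _; ring.
  by apply: sumr_ge0 => l _; exact: sqr_ge0.
(* Near the minimiser [T / A], but meaningful also for [A = 0]. *)
have := quad (T / (1 + A)).
have A1 : 0 < 1 + A by lra.
move=> /(mulr_ge0 (mulr_ge0 (ltW A1) (ltW A1))).
have -> : (1 + A) * (1 + A) * ((T / (1 + A)) ^+ 2 * A - (T / (1 + A)) *+ 2 * T + S)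
    = T ^+ 2 * A - 2 * (1 + A) * T ^+ 2 + (1 + A) * (1 + A) * S.
  by field; rewrite lt0r_neq0.
have T0 := sqr_ge0 T.
move=> H; rewrite -(ler_pM2l A1) mulrA; nra.
Qed.

(* [psi] is a sum of point evaluations on the zero set of the Horn form, minus
   a small multiple of the coefficient of the square of the first variable; the
   latter stays positive because that coefficient is determined by the former. *)
Lemma horn_separation_simplex D : uniq D -> (forall g, g \in D -> simplex g) ->
  (forall j, ue j \in D) ->
  exists psi, hankel_positive psi D /\ horn_value psi < 0.
Proof.
move=> uD simD ueD.
have [q [x [a atoms]]] := vertex_atoms uD simD ueD.
have [psi1 [e1 e10 psi1P]] := hankel_positive_exists uD.
pose P l := face_point (x l).1 (expR (x l).2).
have P0 l j : 0 <= P l j by apply/face_point_ge0/expR_ge0.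
(* The sum of the point evaluations, cut down to degree 2; on squares over the simplex it sees only
   the parts of degree 1. *)
pose L (g : E) := if degree g == 2 then \sum_l monomial (P l) g else 0.
pose A := 1 + \sum_l a l ^+ 2.
have A0 : 0 < A by rewrite ltr_wpDr// sumr_ge0// => l _; exact: sqr_ge0.
(* Small enough that [e * horn_value psi1] stays below the subtracted [A^-1]. *)
pose e := A^-1 / (1 + `|horn_value psi1|).
have e0 : 0 < e by rewrite divr_gt0 ?invr_gt0// ltr_pwDl.
pose psi (g : E) := L g - A^-1 * (g == ue 0 + ue 0)%:R + e * psi1 g.
have PD l (g h : E) : simplex g -> simplex h ->
    monomial (P l) (g + h) = monomial (P l) g * monomial (P l) h.
  by move=> [_ g0 _] [_ h0 _]; exact: monomialD.
exists psi; split; last first.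
  have -> : horn_value psi = horn_value L
      - A^-1 * horn_value (fun g : E => (g == ue 0 + ue 0)%:R) + e * horn_value psi1.
    rewrite /horn_value !mulr_sumr -sumrB -big_split; apply: eq_bigr => i _ /=.
    by rewrite !mulr_sumr -sumrB -big_split; apply: eq_bigr => j _ /=; rewrite /psi;
      ring.
  have -> : horn_value L = 0.
    have LE i j : L (ue i + ue j) = \sum_l P l i * P l j.
      rewrite /L degreeD !degree_unit eqxx; apply: eq_bigr => l _.
      by rewrite PD ?monomial_unit//; exact: simplex_unit.
    rewrite /horn_value; under eq_bigr do under eq_bigr do rewrite LE mulr_sumr.
    under eq_bigr do rewrite exchange_big/=.
    by rewrite exchange_big/= big1// => l _; exact: horn_face_point.
  have -> : horn_value (fun g : E => (g == ue 0 + ue 0)%:R) = 1.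
    have dE i j : (ue i + ue j == ue 0 + ue 0) = (i == 0) && (j == 0).
      apply/eqP/andP => [ij|[/eqP-> /eqP->]//].
      have [iE jE] := simplex_midpoint (simplex_unit R m' i) (simplex_unit R m' j) ij.
      by split; apply/eqP; exact: unit_exponent_inj.
    rewrite /horn_value (bigD1 0)//= (bigD1 0)//= dE eqxx mulr1 big1 => [|j j0].
      rewrite big1 => [|i i0]; first by rewrite !addr0 /horn -!val_eqE.
      by rewrite big1// => j _; rewrite dE (negbTE i0) mulr0.
    by rewrite dE (negbTE j0) andbF mulr0.
  rewrite mulr1 sub0r addrC subr_lt0 /e mulrAC -mulrA gtr_pMr ?invr_gt0//.
  rewrite ltr_pdivrMr ?ltr_pwDl// mul1r (le_lt_trans (ler_norm _))//.
  by rewrite ltrDr.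
exists (e * e1); first exact: mulr_gt0.
move=> f.
have -> : hankel_form psi D f = hankel_form L D f
    - A^-1 * hankel_form (fun g : E => (g == ue 0 + ue 0)%:R) D f + e * hankel_form
        psi1 D f.
  rewrite /hankel_form !mulr_sumr -sumrB -big_split; apply: eq_bigr => g _ /=.
  by rewrite !mulr_sumr -sumrB -big_split; apply: eq_bigr => h _ /=; rewrite /psi; ring.
pose F l := \sum_(g <- D | degree g == 1) f g * monomial (P l) g.
have -> : hankel_form L D f = \sum_l F l ^+ 2.
  have FE l : F l = \sum_(g <- D) (degree g == 1)%:R * (f g * monomial (P l) g).
    by rewrite /F big_mkcond; apply: eq_bigr => g _; case: ifP; rewrite ?mul1r ?mul0r.
  under [RHS]eq_bigr do rewrite FE expr2 big_distrlr/=.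
  rewrite [RHS]exchange_big/= /hankel_form big_seq [RHS]big_seq; apply: eq_bigr => g gD.
  rewrite [RHS]exchange_big/= big_seq [RHS]big_seq; apply: eq_bigr => h hD.
  have [_ _ dg] := simD g gD; have [_ _ dh] := simD h hD.
  rewrite /L degreeD; have [dgh|dgh] := eqVneq (degree g + degree h) 2.
    have -> : degree g = 1 by apply/eqP; rewrite eq_le dg/=; lra.
    have -> : degree h = 1 by apply/eqP; rewrite eq_le dh/=; lra.
    rewrite mulr_sumr; apply: eq_bigr => l _;
      rewrite (PD l _ _ (simD g gD) (simD h hD)) eqxx mulr1n !mul1r; ring.
  rewrite mulr0 big1// => l _; have [g1|] := eqVneq (degree g) 1;
    last by rewrite !mul0r.
  have [h1|] := eqVneq (degree h) 1; last by rewrite !mul0r mulr0.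
  by rewrite g1 h1 eqxx in dgh.
have -> : hankel_form (fun g : E => (g == ue 0 + ue 0)%:R) D f = f (ue 0) ^+ 2.
  have mid (g h : E) : g \in D -> h \in D -> (g + h == ue 0 + ue 0) =
    (g == ue 0) && (h == ue 0).
    move=> gD hD; apply/eqP/andP => [|[/eqP-> /eqP->]//].
    by move=> /(simplex_midpoint (simD g gD) (simD h hD))[-> ->].
  rewrite /hankel_form (bigD1_seq (ue 0))//= (bigD1_seq (ue 0))//= eqxx mulr1.
  rewrite big_seq_cond big1 => [|h /andP[hD h0]];
    last by rewrite mid// (negbTE h0) andbF mulr0.
  rewrite big_seq_cond big1 ?addr0// => g /andP[gD g0].
  by rewrite big_seq big1// => h hD; rewrite mid// (negbTE g0) mulr0.
have := sum_sqr_cauchy a F; rewrite -atoms -/A => cauchy.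
have : e * (e1 * \sum_(g <- D) f g ^+ 2) <= e * hankel_form psi1 D f.
  by rewrite ler_pM2l.
rewrite mulrA => /le_trans; apply; rewrite lerDr subr_ge0.
by rewrite mulrC ler_pdivrMr// mulrC.
Qed.

End HornSeparation.

(** * Exponents outside the simplex *)

Section HornFamily.
Context (R : realType) (m' : nat).
Notation E := ('rV[R]_(5 + m')).
Notation ue := (unit_exponent R m').
Implicit Types (D : seq E) (psi : E -> R).

(** [lambda] is an inequality of the simplex that [g0] violates. The bounds at 0 and at the [ue i]
    ensure that these are never the exponents removed. *)
Lemma not_simplex_separated (g0 : E) : ~ simplex g0 ->
  exists (lambda : E -> R) (c : R), [/\ {morph lambda : g h / g + h}, c < lambda g0,
    0 <= c & forall i, lambda (ue i) <= c].
Proof.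
move=> ng0.
have [[k gk]|/forallNP gr] := pselect (exists k : 'I_m', g0 0 (rshift 5 k) != 0).
  exists (fun g => Num.sg (g0 0 (rshift 5 k)) * g 0 (rshift 5 k)), 0; split=> //.
  - by move=> g h; rewrite mxE mulrDr.
  - by rewrite -normrEsg normr_gt0.
  - by move=> i; rewrite unit_exponent_rshift mulr0.
have [[i gi]|/forallNP gl] := pselect (exists i : 'I_5, g0 0 (lshift m' i) < 0).
  exists (fun g => - g 0 (lshift m' i)), 0; split=> //.
  - by move=> g h; rewrite mxE opprD.
  - by rewrite oppr_gt0.
  - by move=> j; rewrite unit_exponentE oppr_le0 ler0n.
exists (@degree R m'), 1; split=> //.
- exact: degreeD.
- rewrite ltNge; apply/negP => dg; apply: ng0; split=> //.
    by move=> k; have /negP/negPn/eqP := gr k.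
  by move=> i; have /negP := gl i; rewrite -leNgt.
- by move=> i; rewrite degree_unit.
Qed.

(** Exponents outside the simplex are removed one at a time. Restoring [g] changes [psi] only at
    [g + g], where [lambda] exceeds [2 * c]; no [ue i + ue j] lies there, so the Horn value is
    unchanged. *)
Lemma horn_separation D : uniq D -> 0 \in D -> (forall j, ue j \in D) ->
  exists psi, hankel_positive psi D /\ horn_value psi < 0.
Proof.
have [n] := ubnP (size D); elim: n D => // n IH D nD uD D0 ueD.
have [simD|/existsNP[g0 /not_implyP[g0D]]] := pselect (forall g, g \in D -> simplex g).
  exact: horn_separation_simplex.
move=> /not_simplex_separated[lambda [c [lD cl c0 luc]]].
have [g gD [lg gfree]] := extreme_exponent lD g0D.
have cg : c < lambda g := lt_le_trans cl lg.
have l0 : lambda 0 = 0 by apply: (addrI (lambda 0)); rewrite -lD !addr0.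
have gperm := perm_to_rem gD.
have memr h : lambda h <= c -> h \in D -> h \in rem g D.
  by move=> lh hD; rewrite mem_rem_uniq// inE hD andbT; apply: contraTneq lh => ->;
    rewrite -ltNge.
have [|||psi [psiD psi_horn]] := IH (rem g D) _ (rem_uniq _ uD).
- by rewrite size_rem// prednK//; case: (D) gD.
- by apply: memr => //; rewrite l0.
- by move=> j; apply: memr.
have [||psi' [psi'D psi'E]] := @hankel_positive_cons _ _ psi (rem g D) g _ psiD.
- by rewrite -(perm_uniq gperm).
- by move=> h h'; rewrite -!(perm_mem gperm); exact: gfree.
exists psi'; split; first by apply: perm_hankel_positive psi'D; rewrite perm_sym.
rewrite (_ : horn_value psi' = horn_value psi)//.
apply: eq_bigr => i _; apply: eq_bigr => j _; rewrite psi'E//.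
apply/eqP => /(congr1 lambda); rewrite !lD => lij.
by have := luc i; have := luc j; lra.
Qed.

(** 0 and the [ue j] join the exponents [d i]. The square of the constant 1 shows [psi 0 > 0], which
    permits normalising. *)
Lemma horn_separation_family p (d : 'I_p -> E) : injective d ->
  exists psi, [/\ strongly_positive (fun i j => psi (d i + d j)), psi 0 = 1 &
    horn_value psi < 0].
Proof.
move=> d_inj.
pose D := undup (0 :: [seq ue j | j : 'I_5] ++ [seq d i | i : 'I_p]).
have uD : uniq D by exact: undup_uniq.
have D0 : 0 \in D by rewrite mem_undup mem_head.
have ueD j : ue j \in D by rewrite mem_undup inE mem_cat map_f ?orbT ?mem_enum.
have dD i : d i \in D by rewrite mem_undup inE mem_cat (map_f d) ?orbT ?mem_enum.
have [psi [[e e0 psiD] psi_horn]] := horn_separation uD D0 ueD.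
have psi0 : 0 < psi 0.
  have := psiD (fun g => (g == 0)%:R); rewrite /hankel_form.
  rewrite (bigD1_seq 0)//= eqxx big1 => [|g /negbTE ->]; last by rewrite expr0n.
  rewrite (bigD1_seq 0)//= (bigD1_seq 0)//= eqxx big1 => [|g /negbTE ->]; last first.
    by rewrite mulr0 mul0r.
  rewrite big1 => [|g /negbTE ->]; last by rewrite big1// => h _; rewrite !mul0r.
  by rewrite mulr1n expr1n !addr0 !mulr1 mul1r; exact: lt_le_trans.
exists (fun g => psi g / psi 0); split.
- exists (e / psi 0); first exact: divr_gt0.
  move=> v; pose f g := \sum_i (d i == g)%:R * v i.
  have fd i : f (d i) = v i.
    rewrite /f (bigD1 i)//= eqxx mul1r big1 ?addr0// => j ji.
    by rewrite (inj_eq d_inj) (negbTE ji) mul0r.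
  have sumD (G : E -> R) : \sum_(g <- D) f g * G g = \sum_i v i * G (d i).
    rewrite /f; under eq_bigr do rewrite mulr_suml.
    rewrite exchange_big/=; apply: eq_bigr => i _.
    rewrite (bigD1_seq (d i))//= eqxx mul1r big1 ?addr0// => g gd.
    by rewrite eq_sym (negbTE gd) !mul0r.
  have := psiD f; rewrite /hankel_form; under eq_bigr do rewrite expr2.
  rewrite sumD; under eq_bigr do rewrite fd -expr2.
  have -> : \sum_(g <- D) \sum_(h <- D) f g * f h * psi (g + h) =
      \sum_i \sum_j v i * v j * psi (d i + d j).
    under eq_bigr do under eq_bigr do rewrite -mulrA.
    under eq_bigr do rewrite -mulr_sumr sumD.
    by rewrite sumD; apply: eq_bigr => i _; rewrite mulr_sumr; apply: eq_bigr => j _;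
      rewrite mulrA.
  rewrite -(ler_pM2r (_ : 0 < (psi 0)^-1)) ?invr_gt0// mulrAC => /le_trans; apply.
  rewrite mulr_suml; apply: ler_sum => i _; rewrite mulr_suml; apply: ler_sum => j _.
  by rewrite mulrA.
- by rewrite divff// lt0r_neq0.
- rewrite (_ : horn_value _ = horn_value psi / psi 0); last first.
    rewrite /horn_value mulr_suml; apply: eq_bigr => i _; rewrite mulr_suml.
    by apply: eq_bigr => j _; rewrite mulrA.
  by rewrite pmulr_llt0 ?invr_gt0.
Qed.

End HornFamily.

(** * The Horn form and spectrahedral shadows *)

Section ShadowHorn.
Context (R : realType).

(* [inl (i, j)] indexes [x_i x_j], and [inr tt] the constant 1, which multiplies
   the constant term of the linear matrix inequality. *)
Definition pair_exponent m' (t : ('I_5 * 'I_5) + unit) : 'rV[R]_(5 + m') :=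
  if t is inl (i, j) then unit_exponent R m' i + unit_exponent R m' j else 0.

(** Here [x_i(n) = expR (power_scale i n)]: the logarithms of these sequences are independent modulo
    bounded ones. *)
Definition pair_germ (t : ('I_5 * 'I_5) + unit) (n : nat) : R :=
  if t is inl (i, j) then expR (power_scale R i n) * expR (power_scale R j n) else 1.

Lemma scale_log_unit m' b i n : (forall k, (k < 5)%N -> b k = power_scale R k) ->
  scale_log b (unit_exponent R m' i) n = power_scale R i n.
Proof.
move=> bE; rewrite /scale_log (bigD1 (lshift m' i))//= unit_exponentE eqxx mul1r.
rewrite bE// big1 ?addr0// => k ki; rewrite (_ : unit_exponent _ _ _ _ _ = 0) ?mul0r//.
by rewrite mxE (negbTE ki) andbF.
Qed.

Lemma pair_germE m' b : (forall k, (k < 5)%N -> b k = power_scale R k) ->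
  forall t, pair_germ t = fun n => expR (scale_log b (pair_exponent m' t) n).
Proof.
move=> bE [[i j]|[]]; apply/funext => n /=.
  by rewrite scale_logD !scale_log_unit// expRD.
by rewrite /scale_log big1 ?expR0// => k _; rewrite mxE mul0r.
Qed.

Lemma shadow_horn (X : vectType R) (C : set X) (a : 'I_5 -> 'I_5 -> X) :
  spectrahedral_shadow C ->
  (forall x : 'I_5 -> R, (forall i, 0 < x i) ->
     C (\sum_i \sum_j (x i * x j) *: a i j)) ->
  exists (x : 'I_5 -> R) (s : 'I_5 -> 'I_5 -> R),
    [/\ forall i, 0 < x i, \sum_i \sum_j horn R i j * s i j < 0 &
        C (\sum_i \sum_j (s i j * (x i * x j)) *: a i j)].
Proof.
move=> shadow Ca.
have [U [UU infU]] := ultraFilterLemma (eventually_filter : ProperFilter \oo).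
have ind5 : independent_mod_bounded U 5 (power_scale R).
  exact: independent_power_scale.
have sum_pairs (z : ('I_5 * 'I_5) + unit -> R) (A : ('I_5 * 'I_5) + unit -> X) :
    A (inr tt) = 0 ->
    \sum_t z t *: A t = \sum_i \sum_j z (inl (i, j)) *: A (inl (i, j)).
  move=> A0; rewrite big_sumType/= [X in _ + X]big1 ?addr0 => [|[] _].
    by rewrite [RHS]pair_big/=; apply: eq_bigr => -[].
  by rewrite A0 scaler0.
pose A (t : ('I_5 * 'I_5) + unit) := if t is inl (i, j) then a i j else 0.
(* The five basic growth rates already separate the pair germs; the scale is enlarged only once [w]
   is known. *)
have germ_exp t : has_exponent U (power_scale R) (pair_germ t) (pair_exponent 0 t).
  by rewrite (@pair_germE 0 (power_scale R))//; exact: has_exponent_expR.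
have [||||p [w [w0 wsep wC]]] :=
  @shadow_rescale R U UU X C _ pair_germ A (inr tt) shadow.
- by move=> t; have [] := germ_exp t.
- move=> t t'; have [tt'|tt'] := eqVneq (pair_exponent 0 t) (pair_exponent 0 t').
    by left; rewrite !(@pair_germE 0 (power_scale R))// tt'.
  by right; apply: separated_of_exponent tt' (germ_exp t) (germ_exp t').
- by [].
- move=> n; rewrite sum_pairs//=.
  by apply: (Ca (fun i => expR (power_scale R i n))) => i; exact: expR_gt0.
(* Adjoin logarithms of the [w i] until each [w i] has an exponent; the first five members of the
   scale are kept. *)
have [m2 [b [m25 bE ind_b bw]]] :=
  independent_extend_seq [seq (fun n => ln `|w i n|) | i : 'I_p] ind5.
move: m25 ind_b bw => /subnKC <-; set m' := (m2 - 5)%N => ind_b bw.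
have w_exp i : exists di : 'rV[R]_(5 + m'), has_exponent U b (w i) di.
  have ip : (i < size [seq (fun n => ln `|w i n|) | i : 'I_p])%N.
    by rewrite size_map size_enum_ord.
  have [c] := bw i ip; rewrite (nth_map i) ?size_enum_ord// nth_ord_enum => cb.
  exists (\row_k c k); split=> //.
  apply: bounded_along_eq cb; apply: nearW => n; congr (_ - _).
  by apply: eq_bigr => k _; rewrite mxE.
have [d wd] := choice w_exp.
have d_inj : injective d.
  move=> i j dij; apply/eqP/negPn/negP => ij.
  have wj := wd j; rewrite -dij in wj.
  have [] := wsep _ _ ij; apply: comparable_nnegligible.
    exact: comparable_of_exponent wj.
  exact: comparable_of_exponent wj (wd i).
have [psi [psi_pos psi0 psi_horn]] := horn_separation_family d_inj.
(* [psi] of the exponent of [f]; a germ without exponent gets the default [psi 0], which keeps [Psi]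
   invariant under comparability. *)
pose Psi f := psi (xget 0 [set g | has_exponent U b f g]).
have PsiE f g : has_exponent U b f g -> Psi f = psi g.
  move=> fg; congr psi; apply: (has_exponent_uniq ind_b _ fg).
  by apply: (xgetPex 0 (P := [set g' | has_exponent U b f g'])); exists g.
have germE t : pair_germ t = fun n => expR (scale_log b (pair_exponent m' t) n).
  by apply: pair_germE => k k5; exact: bE.
have germ_exp' t : has_exponent U b (pair_germ t) (pair_exponent m' t).
  by rewrite (germE t); exact: has_exponent_expR.
have [|||n Cn] := filter_ex (wC Psi _ _ _).
- move=> f h fh; congr psi; congr (xget _ _); apply/seteqP; split=> g.
    exact: has_exponent_comparable.
  exact/has_exponent_comparable/comparable_sym.
- by rewrite -[RHS]psi0; exact: PsiE (germ_exp' (inr tt)).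
- move: psi_pos => [e e0 psi_pos]; exists e => // v; apply: le_trans (psi_pos v) _.
  rewrite le_eqVlt; apply/orP; left; apply/eqP.
  apply: eq_bigr => i _; apply: eq_bigr => j _; congr (_ * _).
  by rewrite (PsiE _ (d i + d j))//; exact: has_exponentM.
exists (fun i => expR (power_scale R i n)),
  (fun i j => psi (unit_exponent R m' i + unit_exponent R m' j)); split=> //.
  by move=> i; exact: expR_gt0.
move: Cn; rewrite sum_pairs//=; congr (C _).
apply: eq_bigr => i _; apply: eq_bigr => j _.
by rewrite (PsiE _ _ (germ_exp' (inl (i, j)))).
Qed.

End ShadowHorn.

(** * Symmetric cones *)

Section ConeFrame.
Context (R : realType) (E : vectType R) (dot : {dot E for idfun}).

Lemma dot_eq (u v : E) : (forall y, dot y u = dot y v) -> u = v.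
Proof.
move=> uv; apply/eqP; rewrite -subr_eq0; apply: contraT.
move=> /(@neq0_dnorm_gt0 _ _ _ dot); rewrite linearBr/=.
by rewrite uv subrr ltxx.
Qed.

Lemma dot_gt0 (u : E) : u != 0 -> 0 < dot u u.
Proof. by move=> u0; exact: neq0_dnorm_gt0. Qed.

(** Idempotents are squares, hence in [K]. Associativity moves one factor of [c_i = c_i o c_i]
    across the inner product, where it meets [c_j] and gives 0. *)
Lemma jordan_frame_cone (K : set E) r : cone_rank dot K r -> (5 <= r)%N ->
  exists c : 'I_5 -> E, [/\ forall i, K (c i), forall i, c i != 0 &
    forall i j, i != j -> dot (c i) (c j) = 0].
Proof.
move=> [prod [[[prodC _ _] assoc] <- [c [prim orth _]]]] r5.
exists (fun i => c (widen_ord r5 i)); split=> [i|i|i j ij].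
- by exists (c (widen_ord r5 i)) => //; have [] := prim (widen_ord r5 i).
- by have [] := prim (widen_ord r5 i).
- have [ci _ _] := prim (widen_ord r5 i).
  by rewrite -ci assoc orth ?linear0r// -val_eqE.
Qed.

Context (c : 'I_5 -> E).

(** A single [c_i (x) c_j] need not be self-adjoint; its symmetrisation is, so [vsproj] leaves it
    unchanged. *)
Definition sym_tensor (i j : 'I_5) : subvs_of (self_adjoint dot) :=
  vsproj _ (2^-1 *: (tensor dot (c i) (c j) + tensor dot (c j) (c i))).

Lemma dot_sym_tensor (k : 'I_5 -> 'I_5 -> R) (y z : E) :
  dot y ((vsval (\sum_i \sum_j k i j *: sym_tensor i j) : 'End(E)) z) =
  \sum_i \sum_j k i j * ((dot (c i) y * dot (c j) z + dot (c j) y * dot (c i) z) / 2).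
Proof.
rewrite linear_sum/= sum_lfunE dot_sumr; apply: eq_bigr => i _.
rewrite linear_sum/= sum_lfunE dot_sumr; apply: eq_bigr => j _.
rewrite scale_lfunE dotZr; congr (_ * _).
rewrite vsprojK; last first.
  apply/self_adjointP => u v; rewrite !scale_lfunE !add_lfunE !tensorE.
  rewrite dotZl dotZr dotDl dotDr !dotZl !dotZr ![dot u _]dotC.
  by ring.
rewrite scale_lfunE add_lfunE !tensorE dotZr dotDr !dotZr ![dot y _]dotC.
by ring.
Qed.

End ConeFrame.

Theorem theorem3p2 (R : realType) (E : vectType R) (dot : {dot E for idfun})
    (K : set E) (r : nat)
    (hK : symmetric_cone dot K) (hrank : cone_rank dot K r) (hr : (5 <= r)%N) :
  ~ spectrahedral_shadow (copositive_cone dot K) /\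
  ~ spectrahedral_shadow (completely_positive_cone dot K).
Proof.
have [coneK _ Kdual _] := hK.
have [c [Kc c0 orth]] := jordan_frame_cone hrank hr.
have dotK u v : K u -> K v -> 0 <= dot u v by rewrite {1}Kdual => Ku /Ku.
have sumK (x : 'I_5 -> R) (u : 'I_5 -> E) :
    (forall i, 0 <= x i) -> (forall i, K (u i)) -> K (\sum_i x i *: u i).
  move=> x0 Ku; rewrite Kdual => v Kv; rewrite dot_suml; apply: sumr_ge0 => i _.
  by rewrite dotZl mulr_ge0// dotK.
(* The family in [K] biorthogonal to the [x_i c_i]. *)
pose dual (x : 'I_5 -> R) i := (x i * dot (c i) (c i))^-1 *: c i.
have dualE x i j : (forall i, 0 < x i) -> dot (c i) (dual x j) = (i == j)%:R / x i.
  move=> x0; rewrite dotZr; have [<-|ij] := eqVneq i j;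
    last by rewrite (orth _ _ ij) mulr0 mul0r.
  rewrite mulr1n mul1r invfM mulfVK// lt0r_neq0// dot_gt0//.
have dualK x i : (forall i, 0 < x i) -> K (dual x i).
  by move=> x0; apply: coneK => //; rewrite invr_ge0 mulr_ge0 ?dot_ge0// ltW.
split=> shadow.
(* Copositive cone: the Horn matrix is put into the family, and the test vector is the sum of the
   [dual x i], on which [x_i x_j] cancels. *)
- have [x Kx|x [s [x0 s_horn CA]]] := shadow_horn (a :=
    fun i j => horn R i j *: sym_tensor dot c i j) shadow.
    move=> z Kz; under eq_bigr do under eq_bigr do rewrite scalerA.
    rewrite dot_sym_tensor.
    have := @horn_copositive R (fun i => x i * dot (c i) z).
    have xz i : 0 <= x i * dot (c i) z by rewrite mulr_ge0 ?dotK// ltW.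
    move=> /(_ xz); congr (0 <= _); apply: eq_bigr => i _; apply: eq_bigr => j _.
    by field.
  have Kd : K (\sum_i dual x i).
    have := sumK (fun=> 1) (dual x) (fun=> ler01) (fun i => dualK x i x0).
    by under eq_bigr do rewrite scale1r.
  have := CA _ Kd; rewrite leNgt => /negP; apply.
  have -> : \sum_i \sum_j (s i j * (x i * x j)) *: (horn R i j *: sym_tensor dot c i
    j) =
      \sum_i \sum_j (s i j * (x i * x j) * horn R i j) *: sym_tensor dot c i j.
    by apply: eq_bigr => i _; apply: eq_bigr => j _; rewrite scalerA.
  rewrite dot_sym_tensor; apply: le_lt_trans s_horn.
  rewrite le_eqVlt; apply/orP; left; apply/eqP.
  have dot_dual i : dot (c i) (\sum_j dual x j) = (x i)^-1.
    rewrite dot_sumr (bigD1 i)//= dualE// eqxx mul1r big1 ?addr0// => j ji.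
    by rewrite dualE// eq_sym (negbTE ji) mul0r.
  apply: eq_bigr => i _; apply: eq_bigr => j _; rewrite !dot_dual.
  by field; rewrite !lt0r_neq0.
(* Completely positive cone: the family consists of the tensor squares of [sum_i x_i c_i], and the
   Horn matrix moves into the test form. *)
- have [x Kx|x [s [x0 s_horn [m [u [_ Ku BE]]]]]] := shadow_horn (a :=
    sym_tensor dot c) shadow.
    exists 1%N, (fun=> \sum_i x i *: c i); split=> // [_|].
      by apply: sumK => // i; exact: ltW.
    rewrite big_ord1; apply/lfunP => z; apply: (@dot_eq _ _ dot) => y.
    rewrite dot_sym_tensor tensorE dotZr [dot y _]dotC !dot_suml.
    transitivity (\sum_i \sum_j (x i * x j) * (dot (c i) z * dot (c j) y)); last first.
      rewrite big_distrlr/=; apply: eq_bigr => i _; apply: eq_bigr => j _.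
      by rewrite !dotZl; ring.
    pose T i j := x i * x j * (dot (c i) z * dot (c j) y).
    transitivity (\sum_i \sum_j (T i j / 2 + T j i / 2)).
      by apply: eq_bigr => i _; apply: eq_bigr => j _; rewrite /T; ring.
    under eq_bigr do rewrite big_split/=.
    rewrite big_split/= [X in _ + X]exchange_big/= -big_split; apply: eq_bigr => i _ /=.
    by rewrite -big_split; apply: eq_bigr => j _ /=; rewrite /T; field.
  (* Each summand [u_k (x) u_k] contributes the Horn form at the nonnegative numbers
     [dot (u k) (dual x i)]. *)
  have form_ge0 : 0 <= \sum_i \sum_j horn R i j *
      dot (dual x i) ((vsval (\sum_k \sum_l (s k l * (x k * x l)) *: sym_tensor dot c
        k l) : 'End(E)) (dual x j)).
    rewrite BE; under eq_bigr do under eq_bigr do rewrite sum_lfunE dot_sumr mulr_sumr.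
    under eq_bigr do rewrite exchange_big/=.
    rewrite exchange_big/=; apply: sumr_ge0 => k _.
    have := @horn_copositive R (fun i => dot (u k) (dual x i)).
    have ux i : 0 <= dot (u k) (dual x i) by apply: dotK => //; exact: dualK.
    move=> /(_ ux); congr (0 <= _); apply: eq_bigr => i _; apply: eq_bigr => j _.
    rewrite tensorE (dotZr dot (dot (u k) (dual x j))) [dot (dual x i) _]dotC.
    by rewrite [X in _ = _ * X]mulrC.
  move: form_ge0; rewrite leNgt => /negP; apply; apply: le_lt_trans s_horn.
  rewrite le_eqVlt; apply/orP; left; apply/eqP.
  (* Only the symmetric part of [s] is visible here; pairing it with the symmetric Horn matrix gives
     the same sum. *)
  have valE i j : dot (dual x i) ((vsval (\sum_k \sum_l (s k l * (x k * x l)) *: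
      sym_tensor dot c k l) : 'End(E)) (dual x j)) = (s i j + s j i) / 2.
    rewrite dot_sym_tensor.
    pose V i j := s i j / 2.
    transitivity (\sum_k \sum_l ((k == i)%:R * (l == j)%:R * V k l + (k == j)%:R * (l
      == i)%:R * V k l)).
      apply: eq_bigr => k _; apply: eq_bigr => l _; rewrite !dualE// /V.
      by field; rewrite !lt0r_neq0.
    have pick i' j' : \sum_k \sum_l (k == i')%:R * (l == j')%:R * V k l = V i' j'.
      rewrite (bigD1 i')//= (bigD1 j')//= !eqxx !mul1r big1 => [|l /negbTE ->];
        last first.
        by rewrite mulr0 mul0r.
      rewrite big1 ?addr0// => k /negbTE ->; rewrite big1// => l _.
      by rewrite !mul0r.
    under eq_bigr do rewrite big_split/=.
    by rewrite big_split/= !pick /V mulrDl.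
  under eq_bigr do under eq_bigr do rewrite valE mulrA mulrDr mulrDl.
  under eq_bigr do rewrite big_split/=.
  rewrite big_split/= [X in _ + X]exchange_big/= -big_split; apply: eq_bigr => i _ /=.
  rewrite -big_split; apply: eq_bigr => j _ /=.
  by rewrite (hornC R j i); field.
Qed.
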